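(* Suppose $\kappa\neq 0$ and fix $\beta_{(1)}\in\mathbb C$. Let $m\in\mathbb N$, let $V_{\lambda-m,\kappa}$ be the imaginary Verma module and let $v_{\lambda-m,\kappa}\in V_{\lambda-m,\kappa}$ be an imaginary highest weight vector of highest weight $\lambda-m$. For $(n_1,\dots,n_r)=(n_1,\dots,n_r,0,0,\dots)$ with $n_i\in\mathbb N$ define $$\beta_{(n_1,\dots,n_r)}=\frac{m^{\,n_r+\cdots+n_1-1}}{(-\kappa)^{\,n_r+\cdots+n_1-1}\,\big(r^{n_r}\cdots 2^{n_2}\big)\cdot n_r!\cdots n_1!}\cdot\beta_{(1)} .$$ For a partition $$\pi=(\underbrace{-1,\dots,-1}_{n_1},\underbrace{-2,\dots,-2}_{n_2},\dots,\underbrace{-r,\dots,-r}_{n_r})$$ of $-n$ (so $\sum_{l=1}^r l\,n_l=n$) put $\alpha_\pi=\beta_{(n_1,\dots,n_r)}$ and $h_\pi=h_{-1}^{n_1}h_{-2}^{n_2}\cdots h_{-r}^{n_r}$, and let $P_n$ be the set of all such $\pi$. Then the vector $$v^\sharp_{\lambda,\kappa}:=\sum_{n\in\mathbb N}\ \sum_{\pi\in P_n}\alpha_\pi\,h_\pi v_{\lambda-m,\kappa}\otimes u^m_n\ \in\ V_{\lambda-m,\kappa}\,\hat\otimes\,\mathfrak F_m(z)$$ is an imaginary highest weight vector of weight $\lambda$. Hence there is a nonzero $\hat{\mathfrak g}$-module homomorphism $\Phi^V(z):V_{\lambda,\kappa}\to V_{\lambda-m,\kappa}\,\hat\otimes\,\mathfrak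 F_m(z)$ such that $\Phi^V(z)(v_{\lambda,\kappa})=v^\sharp_{\lambda,\kappa}$.
   Context: Let $e,f,h$ be the standard basis of $\mathfrak g=\mathfrak{sl}(2,\mathbb C)$ and $(X|Y)=\mathrm{tr}(XY)$. $\hat{\mathfrak g}=\mathfrak g\otimes\mathbb C[t,t^{-1}]\oplus\mathbb Cc$ with $c$ central, $X_n=X\otimes t^n$, and $[X_p,Y_n]=[X,Y]_{p+n}+\delta_{p+n,0}\,p\,(X|Y)\,c$. $\tilde{\mathfrak g}=\hat{\mathfrak g}\oplus\mathbb Cd$ with $[d,X_n]=nX_n$, $[d,c]=0$. Put $\hat{\mathfrak n}^+=(\mathbb Ce\otimes\mathbb C[t,t^{-1}])\oplus(\mathbb Ch\otimes t\mathbb C[t])$ and $\tilde{\mathfrak h}=\mathbb Ch\oplus\mathbb Cc\oplus\mathbb Cd$. A weight $\lambda$ of $\mathfrak h=\mathbb Ch$ is identified with the number $\lambda(h)$. Imaginary Verma module: $V_{\lambda,\kappa}$ is the $\tilde{\mathfrak g}$-module induced from the one-dimensional $(\tilde{\mathfrak h}\oplus\hat{\mathfrak n}^+)$-module $\mathbb Cv_{\lambda,\kappa}$ on which $\hat{\mathfrak n}^+$ acts by $0$, $h$ by $\lambda$, $c$ by $\kappa$, and $d$ by $-\Delta(\lambda)$, where $\Delta(\lambda)=\frac{\langle\lambda,\lambda+2\rho\rangle}{2(\kappa+2)}$, $\kappa\ne-2$; here $\langle\cdot,\cdot\rangle$ is the form on $\mathfrak h^*$ induced by the trace form and $\rho$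 is half the positive root of $\mathfrak g$. A vector is an imaginary highest weight vector of weight $\lambda$ (at level $\kappa$) if it is annihilated by $\hat{\mathfrak n}^+$, $h$ acts on it by $\lambda$ and $c$ acts on it by $\kappa$. The module is graded by $\deg v_{\lambda,\kappa}=0$, $\deg X_n=n$. $\mathfrak F_m$ is the finite-dimensional $\mathfrak{sl}(2,\mathbb C)$-module of highest weight $m$ with highest weight vector $u^m$; $\mathfrak F_m(z)$ is its evaluation $\hat{\mathfrak g}$-module, $X_n u=z^nXu$, $cu=0$; and $u^m_n=u^m\otimes z^n\in\mathfrak F_m(z)$, i.e. $z^nu^m$. The completed tensor product $V_{\lambda-m,\kappa}\hat\otimes \mathfrak F_m(z)$ is generated by all infinite expressions $\sum_{i\ge1}w_i\otimes v_i$ with $w_i\in V_{\lambda-m,\kappa}$ homogeneous, $\deg w_i\to-\infty$, and $v_i\in\mathfrak F_m(z)$. $\hat{\mathfrak g}$ acts by $X_n\mapsto X_n\otimes1+z^n(1\otimes X)$.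
   Formalization: In β the factor (-κ) is replaced by (-2κ): since (h|h)=2, the printed vector is not annihilated by h_1. m≥1 is assumed, since m=0 gives 0^{-1} and h_1 does not annihilate v^♯. Φ^V(z) is claimed nonzero only if β_(1)≠0 and v_{λ-m,κ}≠0, as otherwise v^♯=0. *)

(* Defs.v *)
From HB Require Import structures.
From mathcomp Require Import all_boot all_order all_algebra.
From mathcomp Require Import generic_quotient ring_quotient.
From mathcomp Require Import finmap monalg.
From mathcomp Require Import boolp classical_sets functions cardinality fsbigop.
From mathcomp Require Import reals complex.

Set Implicit Arguments.
Unset Strict Implicit.
Unset Printing Implicit Defensive.

Import Order.TTheory GRing.Theory Num.Theory.

Local Open Scope classical_set_scope.
Local Open Scope ring_scope.

Section LinearExtension.
Context (K : fieldType) (B : choiceType) (M : lmodType K).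

Definition linext (f : B -> M) (x : {malg K[B]}) : M :=
  \sum_(k <- msupp x) x@_k *: f k.

Lemma linextEw (f : B -> M) (D : {fset B}) (x : {malg K[B]}) :
  {subset msupp x <= D} -> linext f x = \sum_(k <- D) x@_k *: f k.
Proof.
move=> le; rewrite /linext; apply: big_fset_incl; first exact/fsubsetP.
by move=> k _ /mcoeff_outdom ->; rewrite scale0r.
Qed.

Lemma linextP (f : B -> M) : linear (linext f).
Proof.
move=> a x y; pose D := (msupp x `|` msupp y `|` msupp (a *: x + y))%fset.
rewrite !(@linextEw f D);
  try by move=> k kx; rewrite !in_fsetE kx ?orbT.
rewrite scaler_sumr -big_split; apply: eq_bigr => k _ /=.
by rewrite mcoeffD mcoeffZ scalerDl scalerA.
Qed.

HB.instance Definition _ (f : B -> M) :=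
  GRing.isLinear.Build K {malg K[B]} M _ (linext f) (linextP f).

Lemma linextU (f : B -> M) (k : B) : linext f << k >> = f k.
Proof.
rewrite (@linextEw f [fset k]%fset); last exact/fsubsetP/msuppU_le.
by rewrite big_seq_fset1 mcoeffUU scale1r.
Qed.

End LinearExtension.

(** For a Lie algebra L with bracket br, a subalgebra b and a character chi   *)
(** of b, the module U(L) (x)_{U(b)} K_chi induced from the one-dimensional    *)
(** b-module given by chi.  The free vector space on words in L, modulo        *)
(** rel_lin, is the tensor algebra of L; modulo rel_br it becomes U(L), and    *)
(** rel_chi then divides out the left ideal generated by the x - chi x.        *)
Section Induced.
Context (K : fieldType) (L : lmodType K) (br : L -> L -> L).
Context (b : L -> Prop) (chi : L -> K).

Inductive ind_rel : {malg K[seq L]} -> Prop :=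
| rel_lin w1 w2 (a : K) (x y : L) :
    ind_rel (<< w1 ++ (a *: x + y) :: w2 >>
             - (a *: << w1 ++ x :: w2 >> + << w1 ++ y :: w2 >>))
| rel_br w1 w2 (x y : L) :
    ind_rel (<< w1 ++ [:: x, y & w2] >> - << w1 ++ [:: y, x & w2] >>
             - << w1 ++ br x y :: w2 >>)
| rel_chi w (x : L) : b x -> ind_rel (<< rcons w x >> - chi x *: << w >>)
| rel_zero : ind_rel 0
| rel_comb (a : K) s t : ind_rel s -> ind_rel t -> ind_rel (a *: s + t).

Definition ind_relb : {pred {malg K[seq L]}} := fun t => `[< ind_rel t >].

Lemma ind_relP t : reflect (ind_rel t) (t \in ind_relb).
Proof. exact: asboolP. Qed.

Lemma ind_rel_zmod_closed : zmod_closed ind_relb.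
Proof.
split; first by apply/ind_relP; exact: rel_zero.
move=> s t /ind_relP hs /ind_relP ht; apply/ind_relP.
by rewrite addrC -scaleN1r; exact: rel_comb.
Qed.

HB.instance Definition _ :=
  GRing.isZmodClosed.Build {malg K[seq L]} ind_relb ind_rel_zmod_closed.

Local Open Scope quotient_scope.

Local Notation quotT := (Quotient.quot (ind_relb : zmodClosed _)).
Definition ind_mod : Type := quotT.
HB.instance Definition _ := GRing.Zmodule.on ind_mod.

Definition ind_pi (t : {malg K[seq L]}) : ind_mod := \pi_quotT t.
Definition ind_repr (v : ind_mod) : {malg K[seq L]} :=
  repr (v : quotT).

Lemma ind_reprK v : ind_pi (ind_repr v) = v.
Proof. exact: reprK. Qed.

Lemma ind_piP s t : ind_pi s = ind_pi t <-> ind_rel (s - t).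
Proof.
split=> [/eqP|/ind_relP h]; first by rewrite eqquotE => /ind_relP.
by apply/eqP; rewrite eqquotE.
Qed.

Lemma ind_piD s t : ind_pi (s + t) = ind_pi s + ind_pi t.
Proof. exact: (raddfD (\pi_quotT)). Qed.

Definition ind_scale (a : K) (v : ind_mod) : ind_mod :=
  ind_pi (a *: ind_repr v).

Lemma ind_scaleE a t : ind_scale a (ind_pi t) = ind_pi (a *: t).
Proof.
apply/ind_piP; rewrite -scalerBr -[a *: _]addr0; apply: rel_comb.
  by apply/ind_piP; rewrite ind_reprK.
exact: rel_zero.
Qed.

Fact ind_scaleA a c v :
  ind_scale a (ind_scale c v) = ind_scale (a * c) v.
Proof. by rewrite -[v]ind_reprK !ind_scaleE scalerA. Qed.

Fact ind_scale1 : left_id 1 ind_scale.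
Proof. by move=> v; rewrite -[v]ind_reprK ind_scaleE scale1r. Qed.

Fact ind_scaleDr : right_distributive ind_scale +%R.
Proof.
move=> a u v; rewrite -[u]ind_reprK -[v]ind_reprK.
by rewrite -ind_piD !ind_scaleE scalerDr ind_piD.
Qed.

Fact ind_scaleDl v : {morph ind_scale^~ v : a c / a + c}.
Proof.
move=> a c; rewrite -[v]ind_reprK !ind_scaleE scalerDl ind_piD.
by [].
Qed.

HB.instance Definition _ := GRing.Zmodule_isLmodule.Build K ind_mod
  ind_scaleA ind_scale1 ind_scaleDr ind_scaleDl.

Lemma ind_piZ a t : ind_pi (a *: t) = a *: ind_pi t.
Proof. by rewrite -ind_scaleE. Qed.

Definition ind_gen : ind_mod := ind_pi << [::] >>.

Definition word_act (x : L) : {malg K[seq L]} -> {malg K[seq L]} :=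
  linext (fun w => << x :: w >>).
HB.instance Definition _ x := GRing.Linear.on (word_act x).

Definition ind_act (x : L) (v : ind_mod) : ind_mod :=
  ind_pi (word_act x (ind_repr v)).

Lemma word_act_rel x t : ind_rel t -> ind_rel (word_act x t).
Proof.
rewrite /word_act; elim=> {t} [w1 w2 a y z|w1 w2 y z|w y cy||a s t _ hs _ ht].
- by rewrite linearB linearD linearZ /= !linextU; exact: (rel_lin (x :: w1)).
- by rewrite !linearB /= !linextU; exact: (rel_br (x :: w1)).
- by rewrite linearB linearZ /= !linextU; exact: (@rel_chi (x :: w)).
- by rewrite linear0; exact: rel_zero.
- by rewrite linearP; exact: rel_comb.
Qed.

Lemma ind_actE x t : ind_act x (ind_pi t) = ind_pi (word_act x t).
Proof.
apply/ind_piP; rewrite /word_act -linearB; apply: word_act_rel.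
by apply/ind_piP; rewrite ind_reprK.
Qed.

Lemma ind_act_linear x : linear (ind_act x).
Proof.
move=> a u v; rewrite -[u]ind_reprK -[v]ind_reprK -ind_piZ -ind_piD.
by rewrite !ind_actE /word_act linearP ind_piD ind_piZ.
Qed.

HB.instance Definition _ x :=
  GRing.isLinear.Build K ind_mod ind_mod _ (ind_act x) (ind_act_linear x).

Lemma ind_rel_linext (f : seq L -> {malg K[seq L]}) t :
  (forall w, ind_rel (f w)) -> ind_rel (linext f t).
Proof.
move=> hf; rewrite /linext.
apply: (big_ind ind_rel) => [|s r hs hr|w _]; first exact: rel_zero.
  by rewrite -[s]scale1r; exact: rel_comb.
by rewrite -[_ *: _]addr0; apply: rel_comb (hf w) rel_zero.
Qed.

Lemma ind_actDZl (a : K) x y v :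
  ind_act (a *: x + y) v = a *: ind_act x v + ind_act y v.
Proof.
rewrite -[v]ind_reprK !ind_actE -ind_piZ -ind_piD; apply/ind_piP.
set t := ind_repr v; pose f w : {malg K[seq L]} :=
  << (a *: x + y) :: w >> - (a *: << x :: w >> + << y :: w >>).
suff -> : word_act (a *: x + y) t - (a *: word_act x t + word_act y t)
        = linext f t by apply: ind_rel_linext => w; exact: (rel_lin [::]).
rewrite /word_act /linext scaler_sumr -big_split -sumrB.
apply: eq_bigr => w _ /=.
by rewrite /f scalerBr scalerDr !scalerA [t@_w * a]mulrC.
Qed.

Lemma ind_act_br x y v :
  ind_act (br x y) v = ind_act x (ind_act y v) - ind_act y (ind_act x v).
Proof.
rewrite -[v]ind_reprK !ind_actE; set t := ind_repr v.
rewrite -[in RHS]scaleN1r -ind_piZ -ind_piD scaleN1r; apply/esym/ind_piP.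
pose f w : {malg K[seq L]} :=
  << [:: x, y & w] >> - << [:: y, x & w] >> - << br x y :: w >>.
suff -> : word_act x (word_act y t) - word_act y (word_act x t)
          - word_act (br x y) t = linext f t.
  by apply: ind_rel_linext => w; exact: (rel_br [::]).
have E u u' : word_act u (word_act u' t) =
    \sum_(w <- msupp t) t@_w *: << [:: u, u' & w] >>.
  rewrite [word_act u' t]/word_act /linext linear_sum; apply: eq_bigr => w _.
  by rewrite linearZ /= /word_act linextU.
rewrite !E /word_act /linext -!sumrB; apply: eq_bigr => w _.
by rewrite -!scalerBr.
Qed.

Lemma ind_act_gen x : b x -> ind_act x ind_gen = chi x *: ind_gen.
Proof.
move=> bx; rewrite ind_actE -ind_piZ /word_act linextU; apply/ind_piP.
exact: (@rel_chi [::]).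
Qed.

End Induced.

Inductive sl2_basis := bas_e | bas_f | bas_h.

Definition sl2_code (x : sl2_basis) : option bool :=
  match x with bas_e => None | bas_f => Some false | bas_h => Some true end.
Definition sl2_decode (c : option bool) : sl2_basis :=
  match c with None => bas_e | Some false => bas_f | Some true => bas_h end.
Lemma sl2_codeK : cancel sl2_code sl2_decode. Proof. by case. Qed.
HB.instance Definition _ := Countable.copy sl2_basis (can_type sl2_codeK).

Inductive aff_basis := Loop of sl2_basis & int | Cen | Der.

Definition aff_code (a : aff_basis) : sl2_basis * int + bool :=
  match a with
  | Loop x n => inl (x, n) | Cen => inr false | Der => inr true
  end.
Definition aff_decode (c : sl2_basis * int + bool) : aff_basis :=
  match c with
  | inl (x, n) => Loop x n | inr false => Cen | inr true => Der
  end.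
Lemma aff_codeK : cancel aff_code aff_decode. Proof. by case. Qed.
HB.instance Definition _ := Countable.copy aff_basis (can_type aff_codeK).

Section Affine.
Context (K : fieldType).

Definition sl2_mx (x : sl2_basis) : 'M[K]_2 :=
  match x with
  | bas_e => delta_mx 0 1
  | bas_f => delta_mx 1 0
  | bas_h => delta_mx 0 0 - delta_mx 1 1
  end.

Definition trform (X Y : 'M[K]_2) : K := \tr (X *m Y).

(** Loop x n, Cen and Der are the basis elements x (x) t^n, c and d, and      *)
(** gtilde is the free vector space on them.                                 *)
Definition gtilde := {malg K[aff_basis]}.

(** X (x) t^n for a traceless matrix X                                       *)
Definition loop_mx (X : 'M[K]_2) (n : int) : gtilde :=
  X 0 1 *: << Loop bas_e n >> + X 1 0 *: << Loop bas_f n >>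
  + X 0 0 *: << Loop bas_h n >>.

Definition aff_br_basis (a b : aff_basis) : gtilde :=
  match a, b with
  | Loop x p, Loop y n =>
      let X := sl2_mx x in let Y := sl2_mx y in
      loop_mx (X *m Y - Y *m X) (p + n)
      + ((p + n == 0)%:R * p%:~R * trform X Y) *: << Cen >>
  | Der, Loop y n => n%:~R *: << Loop y n >>
  | Loop x p, Der => - (p%:~R *: << Loop x p >>)
  | _, _ => 0
  end.

Definition aff_br (x y : gtilde) : gtilde :=
  linext (fun a => linext (aff_br_basis a) y) x.

Definition ghat (x : gtilde) : Prop := x@_Der = 0.

Definition in_nplus (a : aff_basis) : bool :=
  match a with
  | Loop bas_e _ => true
  | Loop bas_h n => 0 < n
  | _ => false
  end.

Definition in_borel (a : aff_basis) : bool :=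
  in_nplus a || (a \in [:: Loop bas_h 0; Cen; Der]).

Definition nplus (x : gtilde) : Prop := {in msupp x, forall a, in_nplus a}.
Definition borel (x : gtilde) : Prop := {in msupp x, forall a, in_borel a}.

(** The trace form identifies a weight lam with the element lam / (h|h) h of  *)
(** the Cartan subalgebra; 2 rho is the positive root, the number 2.          *)
Definition weight_form (lam mu : K) : K :=
  lam * mu / trform (sl2_mx bas_h) (sl2_mx bas_h).

Definition Delta (kap lam : K) : K :=
  weight_form lam (lam + 2) / (2 * (kap + 2)).

Definition borel_char (lam kap : K) (x : gtilde) : K :=
  lam * x@_(Loop bas_h 0) + kap * x@_Cen - Delta kap lam * x@_Der.

Definition imag_verma (lam kap : K) : lmodType K :=
  ind_mod aff_br borel (borel_char lam kap).

Definition verma_act (lam kap : K) :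
    gtilde -> imag_verma lam kap -> imag_verma lam kap :=
  @ind_act K gtilde aff_br borel (borel_char lam kap).

Definition verma_gen (lam kap : K) : imag_verma lam kap :=
  ind_gen aff_br borel (borel_char lam kap).

Definition imag_hwv (M : lmodType K) (act : gtilde -> M -> M)
    (lam kap : K) (v : M) : Prop :=
  [/\ forall x, nplus x -> act x v = 0,
      act << Loop bas_h 0 >> v = lam *: v
    & act << Cen >> v = kap *: v].

Section Graded.
Context (lam kap : K).
Local Notation V := (imag_verma lam kap).

Inductive homog : int -> V -> Prop :=
| homog_gen : homog 0 (verma_gen lam kap)
| homog_act x n k w :
    homog k w -> homog (n + k) (verma_act << Loop x n >> w)
| homog_zero k : homog k 0
| homog_comb k (a : K) u w : homog k u -> homog k w -> homog k (a *: u + w).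

(** the component of degree d of a vector: the value at d of its (unique)     *)
(** finitely supported decomposition into homogeneous components             *)
Definition homog_decomp (w : V) (f : int -> V) : Prop :=
  [/\ forall k, homog k (f k),
      finite_set [set k | f k != 0]
    & w = \sum_(k \in [set: int]) f k].

Definition homog_comp (d : int) (w : V) : V :=
  xget 0 [set f d | f in homog_decomp w].

Context (m : nat).

(** u_0, ..., u_m is the basis of F_m with u_0 = u^m the highest weight       *)
(** vector and u_(i+1) = f u_i; column i of the matrix is the image of u_i.   *)
Definition fin_mx (x : sl2_basis) : 'M[K]_m.+1 :=
  \matrix_(j, i) match x with
  | bas_e => (i == j.+1 :> nat)%:R * (i * (m.+1 - i))%:R
  | bas_f => (j == i.+1 :> nat)%:R
  | bas_h => (i == j)%:R * (m%:R - i.*2%:R)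
  end.

(** A family t stands for the formal sum of the t d n j (x) u_j z^n over all  *)
(** d, n : int and j, where t d n j has degree d: the terms of degree d of an *)
(** infinite expression with degrees tending to -oo add up to an element of   *)
(** V_d (x) F_m(z), and there are none for d large.                           *)
Definition tfamily : lmodType K := int -> int -> 'I_m.+1 -> V.

Definition in_ctensor (t : tfamily) : Prop :=
  [/\ forall d n j, homog d (t d n j),
      exists D : int, forall d, D < d -> t d = 0
    & forall d, finite_set [set n | t d n <> 0]].

(** The Der clause is never used: the action is that of ghat.                *)
Definition ctensor_act_basis (a : aff_basis) (t : tfamily) : tfamily :=
  match a with
  | Loop x p => fun d n j =>
      verma_act << Loop x p >> (t (d - p) n j)
      + \sum_i fin_mx x j i *: t d (n - p) i
  | Cen => fun d n j => verma_act << Cen >> (t d n j)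
  | Der => 0
  end.

Definition ctensor_act (x : gtilde) (t : tfamily) : tfamily :=
  linext (fun a => ctensor_act_basis a t) x.

(** w (x) u_j z^n, for w not necessarily homogeneous                          *)
Definition pure_tensor (w : V) (j : 'I_m.+1) (n : int) : tfamily :=
  fun d n' j' => if (n' == n) && (j' == j) then homog_comp d w else 0.

(** h_{-1}^{n_1} ... h_{-r}^{n_r} v, with n_(l+1) = ns l                       *)
Definition h_mono (r : nat) (ns : 'I_r -> nat) (v : V) : V :=
  foldr (fun (l : 'I_r) w =>
    iter (ns l) (verma_act << Loop bas_h (- (l.+1 : int)) >>) w) v (enum 'I_r).

(** beta_(n_1, ..., n_r), with n_(l+1) = ns l.  The factor 2 = (h|h) is that  *)
(** of [h_l, h_(-l)] = l (h|h) c: annihilation by h_l requires                *)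
(** 2 kap l n_l beta_(..., n_l, ...) = - m beta_(..., n_l - 1, ...).          *)
Definition beta (beta1 : K) (r : nat) (ns : 'I_r -> nat) : K :=
  let N : int := (\sum_(l < r) ns l)%N in
  m%:R ^ (N - 1)
  / ((- (2 * kap)) ^ (N - 1)
     * \prod_(l < r) (l.+1%:R ^+ ns l) * \prod_(l < r) (ns l)`!%:R)
  * beta1.

(** A partition of n as its multiplicities: nu l is the number of parts equal *)
(** to l + 1.  Parts and multiplicities never exceed n.                       *)
Definition partitions (n : nat) : {set {ffun 'I_n -> 'I_n.+1}} :=
  [set nu : {ffun 'I_n -> 'I_n.+1} | (\sum_(l < n) l.+1 * nu l == n)%N]%SET.

(** The sum over n is locally finite: its n-th term lives in z-degree n.      *)
Definition v_sharp (beta1 : K) (v : V) : tfamily :=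
  fun d k j => \sum_(n \in [set: nat])
    (\sum_(nu in partitions n)
       beta beta1 (fun l => nu l) *:
         pure_tensor (h_mono (fun l => nu l) v) ord0 n) d k j.

End Graded.
End Affine.

(* Main.v *)
From HB Require Import structures.
Require Import Defs.
From mathcomp Require Import all_boot all_order all_algebra.
From mathcomp Require Import finmap monalg.
From mathcomp Require Import boolp classical_sets functions cardinality fsbigop.
From mathcomp Require Import reals complex.
From mathcomp Require Import ring zify.

(** The summand of z-degree n is T_n v, where sum_n T_n z^n is a constant times
    exp (- sum_l m / (2 kap l) h_{-l} z^l).  On the Fock space generated by v,
    h_p with p > 0 acts as 2 kap p d/dh_{-p}, whence h_p T_n v = - m T_{n-p} v,
    and this cancels the contribution m T_{n-p} v of the factor F_m(z); the
    e_p kill both factors.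

    The vector v is not assumed homogeneous, so it is first split into
    components v_k, which are distinguished by their eigenvalue under d and are
    again singular.  The family attached to v_k has constant total degree k,
    hence becomes an eigenvector of d once d acts by the suitably shifted total
    degree; the universal property of the induced gtilde-module then gives a
    map for each k, and Phi is the sum of these. *)

Set Implicit Arguments.
Unset Strict Implicit.
Unset Printing Implicit Defensive.

Import Order.TTheory GRing.Theory Num.Theory.

Local Open Scope classical_set_scope.
Local Open Scope ring_scope.

(** * Linear maps on free vector spaces *)

Lemma malgU_scale (K : fieldType) (B : choiceType) (a : K) (k : B) :
  << a *g k >> = a *: << k >> :> {malg K[B]}.
Proof. by apply/malgP => j; rewrite mcoeffZ !mcoeffU mulr_natr. Qed.

(** Reduces an identity between two linear maps to basis elements: both sides are written as
    [linext] and compared there. *)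
Lemma linear_linext (K : fieldType) (B : choiceType) (M : lmodType K)
    (F : {malg K[B]} -> M) :
  linear F -> forall x, F x = linext (fun k => F << k >>) x.
Proof.
move=> linF x; pose G : {linear {malg K[B]} -> M} := HB.pack F
  (GRing.isLinear.Build K {malg K[B]} M _ F linF).
rewrite /linext {1}[x]monalgE -[F]/(G : _ -> _) linear_sum.
by apply: eq_bigr => k _; rewrite malgU_scale linearZ.
Qed.

Lemma linext_linf (K : fieldType) (B : choiceType) (M : lmodType K)
    (a : K) (f g : B -> M) x :
  linext (fun k => a *: f k + g k) x = a *: linext f x + linext g x.
Proof.
rewrite /linext scaler_sumr -big_split; apply: eq_bigr => k _ /=.
by rewrite scalerDr !scalerA mulrC.
Qed.

(** * The universal property of induced modules *)

Section InducedModule.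
Context (K : fieldType) (L : lmodType K) (br : L -> L -> L).
Context (b : L -> Prop) (chi : L -> K).
Local Notation V := (ind_mod br b chi).
Local Notation act := (@ind_act K L br b chi).

(** Words span the quotient, and each word arises from the empty one by acting with its letters in
    turn. *)
Lemma ind_mod_ind (P : V -> Prop) :
    (forall a u w, P u -> P w -> P (a *: u + w)) ->
    P (ind_gen br b chi) -> (forall x w, P w -> P (act x w)) ->
  forall w, P w.
Proof.
move=> PD Pgen Pact w.
have P0 : P 0 by rewrite -(addNr (ind_gen br b chi)) -scaleN1r; apply: PD.
have Pw (s : seq L) : P (ind_pi br b chi << s >>).
  elim: s => // x s IH; move: (Pact x _ IH).
  by rewrite ind_actE /word_act linextU.
rewrite -[w]ind_reprK; move: (ind_repr w) => t; rewrite [t]monalgE.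
elim: (msupp t : seq _) => [|s r IH].
  by rewrite big_nil -[0](scale0r 0) ind_piZ scale0r.
rewrite big_cons ind_piD.
by rewrite malgU_scale ind_piZ; exact: PD.
Qed.

Section Universal.
Context (M : lmodType K) (rho : L -> M -> M) (m0 : M).
Hypothesis rho_linl : forall t, linear (rho^~ t).
Hypothesis rho_linr : forall x, linear (rho x).
Hypothesis rho_br : forall x y t,
  rho (br x y) t = rho x (rho y t) - rho y (rho x t).
Hypothesis rho_chi : forall x, b x -> rho x m0 = chi x *: m0.

Let word_val (w : seq L) : M := foldr rho m0 w.

(** The three families of relations are killed, respectively, by linearity in the algebra element,
    by the bracket identity and by the character condition on [m0]. Hence evaluation of words
    descends to the quotient. *)
Lemma word_val_rel t : ind_rel br b chi t -> linext word_val t = 0.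
Proof.
have rhoB x y z : rho x (y - z) = rho x y - rho x z.
  by rewrite [in LHS]addrC [in RHS]addrC -!scaleN1r rho_linr.
have rhoZ x a y : rho x (a *: y) = a *: rho x y.
  have rho0 : rho x 0 = 0 by move: (rhoB x 0 0); rewrite !subrr.
  by rewrite -[a *: y]addr0 rho_linr rho0 addr0.
have cat_val w1 w2 : word_val (w1 ++ w2) = foldr rho (word_val w2) w1.
  by rewrite /word_val foldr_cat.
have fB w u v : foldr rho (u - v) w = foldr rho u w - foldr rho v w.
  by elim: w => //= x w ->; rewrite rhoB.
have fZ w a u : foldr rho (a *: u) w = a *: foldr rho u w.
  by elim: w => //= x w ->; rewrite rhoZ.
elim=> {t} [w1 w2 a x y|w1 w2 x y|w x bx||a s t _ hs _ ht].
- rewrite linearB linearD linearZ /= !linextU !cat_val /= rho_linl.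
  apply/eqP; rewrite subr_eq0; apply/eqP.
  by elim: w1 => //= z w1 ->; rewrite rho_linr.
- rewrite !linearB /= !linextU !cat_val /= rho_br fB.
  by rewrite subrr.
- rewrite linearB linearZ /= !linextU -cats1 cat_val /= rho_chi // fZ.
  by rewrite subrr.
- by rewrite linear0.
- by rewrite linearP /= hs ht scaler0 addr0.
Qed.

(** Frobenius reciprocity. The map evaluates any representative, which is legitimate by
    [word_val_rel]; equivariance is checked on words, where both sides are the same [foldr]. *)
Lemma ind_mod_univ : exists Phi : {linear V -> M},
  (forall x w, Phi (act x w) = rho x (Phi w)) /\ Phi (ind_gen br b chi) = m0.
Proof.
pose F (w : V) : M := linext word_val (ind_repr w).
have FE t : F (ind_pi br b chi t) = linext word_val t.
  apply/eqP; rewrite -subr_eq0 /F -linearB /=; apply/eqP/word_val_rel.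
  by apply/ind_piP; rewrite ind_reprK.
have linF : linear F.
  move=> a u w; rewrite -[u]ind_reprK -[w]ind_reprK -ind_piZ -ind_piD !FE.
  by rewrite linearP.
pose Phi : {linear V -> M} := HB.pack F
  (GRing.isLinear.Build K V M _ F linF).
exists Phi; split=> [x w|]; last by rewrite /= FE linextU.
rewrite /= -[w]ind_reprK ind_actE !FE.
have lin1 : linear (fun t => linext word_val (word_act x t)).
  by move=> a s t; rewrite /word_act !linearP.
have lin2 : linear (fun t => rho x (linext word_val t)).
  by move=> a s t; rewrite linearP rho_linr.
rewrite (linear_linext lin1) (linear_linext lin2); congr (linext _ _).
by apply/funext => s; rewrite /word_act !linextU.
Qed.

End Universal.
End InducedModule.

(** * Brackets in sl(2) and in its finite-dimensional modules *)

Section AffineBracket.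
Context (K : fieldType).
Local Notation sl2_br x y :=
  (sl2_mx K x *m sl2_mx K y - sl2_mx K y *m sl2_mx K x).

(** Extends [fin_mx] linearly to traceless matrices, in the coordinates used by [loop_mx]: the upper
    left entry is the coefficient of h. *)
Definition fin_loop m (Z : 'M[K]_2) : 'M[K]_m.+1 :=
  Z 0 1 *: fin_mx K m bas_e + Z 1 0 *: fin_mx K m bas_f
  + Z 0 0 *: fin_mx K m bas_h.


Lemma sl2_br_skew x y : sl2_br x y = - sl2_br y x.
Proof. by rewrite opprB. Qed.

Lemma sl2_brxx x : sl2_br x x = 0.
Proof. exact: subrr. Qed.

Lemma sl2_br_ef : sl2_br bas_e bas_f = sl2_mx K bas_h.
Proof. by rewrite /= !mul_delta_mx. Qed.

Lemma sl2_br_he : sl2_br bas_h bas_e = sl2_mx K bas_e *+ 2.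
Proof.
rewrite /= mulmxBl mulmxBr !mul_delta_mx !mul_delta_mx_0 //.
by rewrite subr0 sub0r opprK mulr2n.
Qed.

Lemma sl2_br_hf : sl2_br bas_h bas_f = - sl2_mx K bas_f *+ 2.
Proof.
rewrite /= mulmxBl mulmxBr !mul_delta_mx !mul_delta_mx_0 //.
by rewrite subr0 sub0r mulr2n.
Qed.

Lemma trform_hh : trform (sl2_mx K bas_h) (sl2_mx K bas_h) = 2.
Proof.
by rewrite /trform /mxtrace !big_ord_recl big_ord0 !mxE !big_ord_recl !big_ord0
  !mxE /= !(subr0, sub0r, mulr0, mul0r, addr0, add0r, mulrNN, mulr1).
Qed.

Lemma trform_he : trform (sl2_mx K bas_h) (sl2_mx K bas_e) = 0.
Proof.
by rewrite /trform /mxtrace !big_ord_recl big_ord0 !mxE !big_ord_recl !big_ord0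
  !mxE /= !(subr0, sub0r, mulr0, mul0r, addr0, add0r, mulrNN, mulr1).
Qed.

Section FinMx.
Context (m : nat).
Local Notation rho := (fin_mx K m).

(** Both products are diagonal: ef multiplies u_j by (j+1)(m-j), fe multiplies it by j(m+1-j), and
    the difference is m-2j. *)
Lemma fin_mx_ef : rho bas_e *m rho bas_f - rho bas_f *m rho bas_e = rho bas_h.
Proof.
apply/matrixP => j i; rewrite !mxE.
have -> : \sum_k rho bas_e j k * rho bas_f k i
    = (j == i)%:R * (j.+1 * (m - j))%:R.
  (* At j = m there is no u_(m+1), and the closed form agrees since its factor m - j vanishes. *)
  have [jm|mj] := ltnP j m; last first.
    have -> : (m - j = 0)%N by apply/eqP; rewrite subn_eq0.
    rewrite muln0 mulr0 big1 // => k _; rewrite !mxE.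
    rewrite (_ : (k == j.+1 :> nat) = false) ?mul0r //.
    by have := ltn_ord k; lia.
  rewrite (bigD1 (Ordinal (jm : (j.+1 < m.+1)%N))) //= big1 => [|k kj].
    by rewrite !mxE /= eqxx mul1r addr0 mulrC eqSS.
  rewrite !mxE (_ : (k == j.+1 :> nat) = false) ?mul0r //.
  by apply: contraNF kj => /eqP kj; apply/eqP/val_inj.
have -> : \sum_k rho bas_f j k * rho bas_e k i
    = (j == i)%:R * (j * (m.+1 - j))%:R.
  case jE : {1 2}(j : nat) => [|j'].
    rewrite mul0n mulr0 big1 // => k _; rewrite !mxE.
    by rewrite (_ : (j == k.+1 :> nat) = false) ?mul0r //; lia.
  have jm : (j' < m.+1)%N by have := ltn_ord j; lia.
  rewrite (bigD1 (Ordinal jm)) //= big1 => [|k kj].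
    rewrite !mxE /= jE eqxx mul1r addr0 -jE.
    case: (eqVneq j i) => [<-|ji]; first by rewrite eqxx !mul1r.
    rewrite (_ : (i == j :> nat) = false) ?mul0r //.
    by apply: contraNF ji => /eqP ij; apply/eqP/val_inj.
  rewrite !mxE (_ : (j == k.+1 :> nat) = false) ?mul0r //.
  by apply: contraNF kj => /eqP kj; apply/eqP/val_inj => /=; lia.
rewrite -mulrBr eq_sym; case: (eqVneq i j) => [->|_]; last by rewrite !mul0r.
have jm : (j <= m)%N by rewrite -ltnS.
have E : (j.+1 * (m - j) + j.*2 = m + j * (m.+1 - j))%N by rewrite subSn //; nia.
by apply/eqP; rewrite !mul1r subr_eq addrAC eq_sym subr_eq -!natrD eq_sym E.
Qed.

Lemma fin_mx_hE : rho bas_h = diag_mx (\row_i (m%:R - i.*2%:R)).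
Proof.
apply/matrixP => j i; rewrite !mxE eq_sym.
by case: eqVneq => [->|_]; rewrite ?mul1r ?mulr1n ?mul0r ?mulr0n.
Qed.

Lemma fin_mx_he :
  rho bas_h *m rho bas_e - rho bas_e *m rho bas_h = rho bas_e *+ 2.
Proof.
rewrite fin_mx_hE; apply/matrixP => j i.
rewrite mul_diag_mx mul_mx_diag !mxE.
case: eqP => [ij|_]; last by rewrite !mul0r mulr0 subr0 addr0.
have -> : i.*2%:R = j.*2%:R + 2 :> K by rewrite ij doubleS -natrD addn2.
by ring.
Qed.

Lemma fin_mx_hf :
  rho bas_h *m rho bas_f - rho bas_f *m rho bas_h = - rho bas_f *+ 2.
Proof.
rewrite fin_mx_hE; apply/matrixP => j i.
rewrite mul_diag_mx mul_mx_diag !mxE.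
case: eqP => [ij|_]; last by rewrite !mulr0 mul0r oppr0 addr0.
have -> : j.*2%:R = i.*2%:R + 2 :> K by rewrite ij doubleS -natrD addn2.
by ring.
Qed.

(** Skew symmetry reduces the nine pairs of basis elements to the relations for [e,f], [h,e] and
    [h,f], which hold in the same form for the 2 by 2 matrices and for [fin_mx]. *)
Lemma fin_mx_br x y : rho x *m rho y - rho y *m rho x = fin_loop m (sl2_br x y).
Proof.
have E0 : fin_loop m 0 = 0 by rewrite /fin_loop !mxE !scale0r !addr0.
have EN Z : fin_loop m (- Z) = - fin_loop m Z.
  by rewrite /fin_loop !mxE !scaleNr !opprD.
have EM Z : fin_loop m (Z *+ 2) = fin_loop m Z *+ 2.
  rewrite /fin_loop !mulr2n !mxE !scalerDl [in RHS]addrACA.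
  by congr (_ + _); rewrite addrACA.
have Ex x' : fin_loop m (sl2_mx K x') = rho x'.
  by case: x'; rewrite /fin_loop /= !mxE /= ?subr0 ?sub0r;
    rewrite ?scale0r ?scale1r ?addr0 ?add0r.
(* The matrices must stay folded for the rewriting by named brackets to find them. *)
Local Opaque sl2_mx.
case: x y => [] [].
all: rewrite ?sl2_brxx ?subrr ?(sl2_br_skew bas_f bas_e).
all: rewrite ?(sl2_br_skew bas_e bas_h) ?(sl2_br_skew bas_f bas_h).
all: rewrite ?sl2_br_ef ?sl2_br_he ?sl2_br_hf.
all: rewrite ?(EN, EM, Ex, E0) -?(fin_mx_ef, fin_mx_he, fin_mx_hf).
all: rewrite ?opprB ?mulNrn ?opprK //.
all: rewrite -?fin_mx_he ?opprB //.
all: try (rewrite -[rho bas_f *+ 2]opprK -mulNrn -fin_mx_hf ?opprB //).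
Qed.
End FinMx.
End AffineBracket.

(** * The affine bracket and its action on the imaginary Verma module *)

Lemma aff_brU (K : fieldType) (a b : aff_basis) :
  aff_br << a >> << b >> = aff_br_basis K a b.
Proof. by rewrite /aff_br !linextU. Qed.

Lemma aff_br_linl (K : fieldType) (y : gtilde K) :
  linear (fun x => aff_br x y).
Proof. by move=> a u v; rewrite /aff_br linearP. Qed.

Lemma aff_br_linr (K : fieldType) (x : gtilde K) : linear (aff_br x).
Proof.
move=> a u v; rewrite /aff_br -linext_linf; congr (linext _ x).
by apply/funext => k; rewrite linearP.
Qed.

Section VermaAction.
Context (K : fieldType) (lam kap : K).
Local Notation V := (imag_verma lam kap).
Local Notation act := (@verma_act K lam kap).

HB.instance Definition _ x := GRing.isLinear.Build K V V _ (act x)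
  (ind_act_linear x).

Lemma verma_act_linl (w : V) : linear (act^~ w).
Proof. by move=> a x y; rewrite /verma_act ind_actDZl. Qed.

Lemma verma_actDl x y (w : V) : act (x + y) w = act x w + act y w.
Proof. by have := verma_act_linl w 1 x y; rewrite !scale1r. Qed.

Lemma verma_act0l (w : V) : act 0 w = 0.
Proof. by apply: (@addIr _ (act 0 w)); rewrite -verma_actDl !add0r. Qed.

Lemma verma_actZl a x (w : V) : act (a *: x) w = a *: act x w.
Proof. by have := verma_act_linl w a x 0; rewrite verma_act0l !addr0. Qed.

Lemma verma_act_br x y (w : V) :
  act (aff_br x y) w = act x (act y w) - act y (act x w).
Proof. exact: ind_act_br. Qed.

Lemma verma_act_brU a b (w : V) :
  act << a >> (act << b >> w) = act << b >> (act << a >> w)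
    + act (aff_br_basis K a b) w.
Proof. by rewrite -aff_brU verma_act_br addrC subrK. Qed.

Lemma verma_actE x (w : V) : act x w = linext (fun a => act << a >> w) x.
Proof. exact: (linear_linext (verma_act_linl w)). Qed.

(** The central element acts by [kap] on the generator and commutes with everything that is applied
    to it. *)
Lemma verma_act_cen (w : V) : act << Cen >> w = kap *: w.
Proof.
elim/ind_mod_ind: w => [a u w hu hw||x w hw].
- by rewrite linearP /= hu hw scalerDr !scalerA mulrC.
- rewrite [act _ _]ind_act_gen => [|a].
    by rewrite /borel_char !mcoeffU /= !(mulr0, add0r, subr0, mulr1).
  by rewrite msuppU oner_eq0 inE => /eqP ->.
- rewrite -[ind_act _ _]/(act x w).
  have := verma_act_br << Cen >> x w.
  have -> : aff_br << Cen >> x = 0.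
    rewrite /aff_br linextU /linext big1 // => k _.
    by rewrite scaler0.
  rewrite verma_act0l hw => /esym/eqP; rewrite subr_eq0 => /eqP ->.
  exact: linearZ.
Qed.

Lemma verma_act_loop_mx Z r (w : V) :
  act (loop_mx Z r) w = Z 0 1 *: act << Loop bas_e r >> w
    + Z 1 0 *: act << Loop bas_f r >> w + Z 0 0 *: act << Loop bas_h r >> w.
Proof.
by rewrite /loop_mx 2!verma_actDl; congr (_ + _ + _); exact: verma_actZl.
Qed.

End VermaAction.

(** * Families of tensors and the action of [gtilde] on them *)

Section Families.
Context (K : fieldType) (lam kap : K) (m : nat).
Implicit Types s t : tfamily lam kap m.

Lemma tfamilyD s t d n j : (s + t) d n j = s d n j + t d n j.
Proof. by []. Qed.

Lemma tfamilyN t d n j : (- t) d n j = - t d n j.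
Proof. by []. Qed.

Lemma tfamilyZ a t d n j : (a *: t) d n j = a *: t d n j.
Proof. by []. Qed.

Definition tfamilyE := (tfamilyD, tfamilyN, tfamilyZ).

Lemma tfamily_sum (I : Type) (r : seq I) (P : pred I)
    (f : I -> tfamily lam kap m) d n j :
  (\sum_(i <- r | P i) f i) d n j = \sum_(i <- r | P i) f i d n j.
Proof. by elim/big_rec2: _ => // i x y _ <-. Qed.

Lemma tfamilyP s t : (forall d n j, s d n j = t d n j) -> s = t.
Proof.
by move=> E; apply/funext => d; apply/funext => n; apply/funext => j.
Qed.

End Families.

Section TensorRep.
Context (K : fieldType) (lam kap : K) (m : nat) (c : K).
Local Notation V := (imag_verma lam kap).
Local Notation act := (@verma_act K lam kap).
Local Notation T := (tfamily lam kap m).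

(* [Der] acts by the total degree shifted by [c]; with [c] chosen so that a
   homogeneous family becomes a [Der]-eigenvector of the required eigenvalue,
   this makes the families a module over the whole of gtilde. *)
Definition tensor_rep_basis (a : aff_basis) (t : T) : T :=
  if a is Der then fun d n j => ((d + n)%:~R - c) *: t d n j
  else ctensor_act_basis a t.

Definition tensor_rep (x : gtilde K) (t : T) : T :=
  linext (tensor_rep_basis^~ t) x.

Lemma tensor_rep_linl t : linear (tensor_rep^~ t).
Proof. exact: linearP. Qed.

Lemma tensor_repDl x y t :
  tensor_rep (x + y) t = tensor_rep x t + tensor_rep y t.
Proof. exact: linearD. Qed.

Lemma tensor_repZl a x t : tensor_rep (a *: x) t = a *: tensor_rep x t.
Proof. exact: linearZ. Qed.

Lemma tensor_rep_basis_lin a : linear (tensor_rep_basis a).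
Proof.
move=> z s t; apply: tfamilyP => d n j; rewrite !tfamilyE.
case: a => [x p||] /=; rewrite ?tfamilyE.
- rewrite linearP scalerDr [RHS]addrACA; congr (_ + _).
  rewrite scaler_sumr -big_split; apply: eq_bigr => i _ /=.
  by rewrite tfamilyE scalerDr !scalerA mulrC.
- by rewrite linearP.
- by rewrite scalerDr !scalerA mulrC.
Qed.

HB.instance Definition _ a := GRing.isLinear.Build K T T _ (tensor_rep_basis a)
  (tensor_rep_basis_lin a).

Lemma tensor_rep_linr x : linear (tensor_rep x).
Proof.
move=> a s t; rewrite /tensor_rep -linext_linf; congr (linext _ x).
by apply/funext => k; rewrite linearP.
Qed.

Lemma tensor_repU a t : tensor_rep << a >> t = tensor_rep_basis a t.
Proof. exact: linextU. Qed.

Lemma tensor_rep_ghat x t : ghat x -> tensor_rep x t = ctensor_act x t.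
Proof.
move=> hx; rewrite /tensor_rep /ctensor_act /linext; apply: eq_bigr => a _.
by case: a => //; rewrite hx !scale0r.
Qed.

(** The noncentral part of a bracket of loops is a [loop_mx]; here its action is split into the two
    tensor factors, the second acting through [fin_loop]. *)
Lemma tensor_rep_loop_mx Z r t d n j :
  tensor_rep (loop_mx Z r) t d n j = act (loop_mx Z r) (t (d - r) n j)
    + \sum_i fin_loop m Z j i *: t d (n - r) i.
Proof.
rewrite verma_act_loop_mx.
have -> : tensor_rep (loop_mx Z r) t =
    Z 0 1 *: tensor_rep_basis (Loop bas_e r) t
    + Z 1 0 *: tensor_rep_basis (Loop bas_f r) t
    + Z 0 0 *: tensor_rep_basis (Loop bas_h r) t.
  rewrite /loop_mx 2!tensor_repDl; congr (_ + _ + _).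
  1-3: by rewrite tensor_repZl tensor_repU.
rewrite 2!tfamilyD 3!tfamilyZ /= !scalerDr.
rewrite [X in X + _ = _]addrACA [LHS]addrACA; congr (_ + _).
rewrite !scaler_sumr -!big_split; apply: eq_bigr => i _ /=.
by rewrite !scalerA -!scalerDl /fin_loop !mxE.
Qed.

Lemma verma_act_br_loop x y p q (w : V) :
  act << Loop x p >> (act << Loop y q >> w)
  - act << Loop y q >> (act << Loop x p >> w)
  = act (loop_mx (sl2_mx K x *m sl2_mx K y - sl2_mx K y *m sl2_mx K x)
      (p + q)) w
    + ((p + q == 0)%:R * p%:~R * trform (sl2_mx K x) (sl2_mx K y))
      *: act << Cen >> w.
Proof.
transitivity (act (aff_br_basis K (Loop x p) (Loop y q)) w).
  by rewrite -aff_brU; exact/esym/verma_act_br.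
apply: etrans (verma_actDl _ _ _) _; congr (_ + _); exact: verma_actZl.
Qed.

(** A product of two operators has a part on the first factor, a part on the second and two mixed
    terms. The mixed terms are symmetric under exchange of the operators, so they cancel in the
    commutator, leaving the commutators in each factor. *)
Lemma tensor_rep_br_loop x y p q t :
  tensor_rep (aff_br_basis K (Loop x p) (Loop y q)) t =
  tensor_rep_basis (Loop x p) (tensor_rep_basis (Loop y q) t)
  - tensor_rep_basis (Loop y q) (tensor_rep_basis (Loop x p) t).
Proof.
apply: tfamilyP => d n j; rewrite tfamilyD tfamilyN.
rewrite -[aff_br_basis _ _ _]/(loop_mx
    (sl2_mx K x *m sl2_mx K y - sl2_mx K y *m sl2_mx K x) (p + q)
  + ((p + q == 0)%:R * p%:~R * trform (sl2_mx K x) (sl2_mx K y)) *: << Cen >>).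
rewrite tensor_repDl. rewrite tensor_repZl tensor_repU tfamilyD tfamilyZ.
rewrite tensor_rep_loop_mx.
have actD a w (f : 'I_m.+1 -> V) (z : 'I_m.+1 -> K) :
    act << a >> (w + \sum_i z i *: f i)
    = act << a >> w + \sum_i z i *: act << a >> (f i).
  rewrite linearD linear_sum; congr (_ + _).
  by apply: eq_bigr => i _; rewrite linearZ.
(* The mixed terms are collected in the last summand, so that they can be cancelled as a block. *)
have comp x' y' p' q' : tensor_rep_basis (Loop x' p')
    (tensor_rep_basis (Loop y' q') t) d n j
  = act << Loop x' p' >> (act << Loop y' q' >> (t (d - (p' + q')) n j))
    + \sum_i (fin_mx K m x' *m fin_mx K m y') j i *: t d (n - (p' + q')) i
    + (\sum_i fin_mx K m y' j i
        *: act << Loop x' p' >> (t (d - p') (n - q') i)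
      + \sum_i fin_mx K m x' j i
        *: act << Loop y' q' >> (t (d - q') (n - p') i)).
  rewrite /= actD opprD !addrA.
  have -> : \sum_i fin_mx K m x' j i *: (act << Loop y' q' >>
        (t (d - q') (n - p') i)
      + \sum_i0 fin_mx K m y' i i0 *: t d (n - p' - q') i0)
    = \sum_i fin_mx K m x' j i *: act << Loop y' q' >> (t (d - q') (n - p') i)
    + \sum_i (fin_mx K m x' *m fin_mx K m y') j i *: t d (n - p' - q') i.
    under eq_bigr do rewrite scalerDr.
    rewrite big_split; congr (_ + _) => /=.
    under eq_bigr do rewrite scaler_sumr.
    rewrite exchange_big; apply: eq_bigr => k _ /=.
    by rewrite mxE scaler_suml; apply: eq_bigr => i _; rewrite scalerA.
  by rewrite -!addrA; congr (_ + _); rewrite [LHS]addrA [LHS]addrC.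
rewrite !comp (addrC q p) [X in _ = _ - (_ + X)]addrC.
rewrite [X in _ = _ + X]opprD [RHS]addrACA subrr.
rewrite addr0 [X in _ = _ + X]opprD [RHS]addrACA.
rewrite [X in _ = X + _]verma_act_br_loop [LHS]addrAC.
apply: (congr2 +%R); first apply: (congr1 (+%R _)).
  (* The central term is evaluated in degree d on one side and d - (p + q) on the other; its
     coefficient vanishes unless p + q = 0. *)
  by case: eqP => [->|_]; rewrite ?subr0 ?mul0r ?scale0r.
rewrite -sumrB -fin_mx_br; apply: eq_bigr => i _.
by rewrite -scalerBl !mxE.
Qed.

(** Each of the two terms of the action of X_p raises the total degree d + n by p, one through d and
    the other through n. The shift [c] drops out of the commutator. *)
Lemma tensor_rep_br_der x p t :
  tensor_rep_basis Der (tensor_rep_basis (Loop x p) t)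
  - tensor_rep_basis (Loop x p) (tensor_rep_basis Der t)
  = p%:~R *: tensor_rep_basis (Loop x p) t.
Proof.
apply: tfamilyP => d n j; rewrite tfamilyD tfamilyN tfamilyZ /= linearZ /=.
rewrite !scalerDr opprD addrACA -scalerBl; congr (_ + _).
  by congr (_ *: _); rewrite !rmorphD rmorphN /=; ring.
rewrite !scaler_sumr -sumrB; apply: eq_bigr => i _.
rewrite !scalerA -scalerBl; congr (_ *: _).
by rewrite !rmorphD rmorphN /=; ring.
Qed.

Lemma tensor_rep_br_cen a t :
  tensor_rep_basis a (tensor_rep_basis Cen t)
  = tensor_rep_basis Cen (tensor_rep_basis a t).
Proof.
have -> s : tensor_rep_basis Cen s = kap *: s.
  by apply: tfamilyP => d n j; rewrite /= verma_act_cen.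
have -> s : tensor_rep_basis Cen s = kap *: s.
  by apply: tfamilyP => d n j; rewrite /= verma_act_cen.
exact: linearZ.
Qed.

Lemma tensor_rep_br_basis a b t :
  tensor_rep (aff_br_basis K a b) t =
  tensor_rep_basis a (tensor_rep_basis b t)
  - tensor_rep_basis b (tensor_rep_basis a t).
Proof.
have rep0 : tensor_rep 0 t = 0 by exact: linear0.
case: a b => [x p||] [y q||]; last by rewrite subrr rep0.
- exact: tensor_rep_br_loop.
- by rewrite tensor_rep_br_cen subrr rep0.
- rewrite -opprB tensor_rep_br_der -tensor_repU -tensor_repZl.
  exact: linearN.
- by rewrite tensor_rep_br_cen subrr rep0.
- by rewrite subrr rep0.
- by rewrite tensor_rep_br_cen subrr rep0.
- by rewrite tensor_rep_br_der -tensor_repU -tensor_repZl.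
- by rewrite tensor_rep_br_cen subrr rep0.
Qed.

(** Bilinearity reduces first [x] and then [y] to basis elements. *)
Lemma tensor_rep_br x y t :
  tensor_rep (aff_br x y) t =
  tensor_rep x (tensor_rep y t) - tensor_rep y (tensor_rep x t).
Proof.
have L1 : linear (fun z => tensor_rep (aff_br z y) t).
  by move=> a u v; rewrite aff_br_linl tensor_rep_linl.
have L2 : linear (fun z =>
    tensor_rep z (tensor_rep y t) - tensor_rep y (tensor_rep z t)).
  move=> a u v; rewrite !tensor_rep_linl tensor_rep_linr scalerBr opprD.
  by rewrite addrACA.
rewrite (linear_linext L1) (linear_linext L2); congr (linext _ x).
apply/funext => a {L1 L2}.
have L1 : linear (fun z => tensor_rep (aff_br << a >> z) t).
  by move=> e u v; rewrite aff_br_linr tensor_rep_linl.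
have L2 : linear (fun z => tensor_rep << a >> (tensor_rep z t)
    - tensor_rep z (tensor_rep << a >> t)).
  move=> e u v; rewrite !tensor_rep_linl tensor_rep_linr scalerBr opprD.
  by rewrite addrACA.
rewrite (linear_linext L1) (linear_linext L2); congr (linext _ y).
apply/funext => b {L1 L2}.
by rewrite aff_brU !tensor_repU tensor_rep_br_basis.
Qed.

End TensorRep.

(** * The grading of the imaginary Verma module by eigenvalues of [Der] *)

Section Grading.
Context (K : numFieldType) (lam kap : K).
Local Notation V := (imag_verma lam kap).
Local Notation act := (@verma_act K lam kap).

(** The generator has eigenvalue -Delta, and [d, X_n] = n X_n adds n for each factor X_n. *)
Lemma verma_act_der_homog k (w : V) :
  homog k w -> act << Der >> w = (k%:~R - Delta kap lam) *: w.
Proof.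
elim=> {k w} [|x n k w _ IH|k|k a u w _ hu _ hw].
- rewrite [act _ _]ind_act_gen => [|a].
    by rewrite /borel_char !mcoeffU /= !(mulr0, add0r, subr0, mulr1).
  by rewrite msuppU oner_eq0 inE => /eqP ->.
- rewrite verma_act_brU IH linearZ /= verma_actZl -scalerDl.
  by congr (_ *: _); rewrite rmorphD /=; ring.
- by rewrite scaler0 linear0.
- by rewrite linearP /= hu hw scalerDr !scalerA mulrC.
Qed.

Lemma homogZ k a (w : V) : homog k w -> homog k (a *: w).
Proof.
by move=> hw; rewrite -[_ *: w]addr0; apply: homog_comb; last exact: homog_zero.
Qed.

Lemma homogD k (u w : V) : homog k u -> homog k w -> homog k (u + w).
Proof. by move=> hu hw; rewrite -[u]scale1r; apply: homog_comb. Qed.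

Lemma homog_sum k (I : Type) (r : seq I) (P : pred I) (f : I -> V) :
  (forall i, P i -> homog k (f i)) -> homog k (\sum_(i <- r | P i) f i).
Proof.
by move=> hf; elim/big_ind: _ => //; [exact: homog_zero|exact: homogD].
Qed.

(* Components of distinct degrees are eigenvectors of [Der] for distinct
   eigenvalues. *)
Lemma homog_indep (s : seq int) (f : int -> V) :
    uniq s -> (forall k, homog k (f k)) -> \sum_(k <- s) f k = 0 ->
  {in s, forall k, f k = 0}.
Proof.
elim: s f => [|k0 s IH] f //= /andP[k0s us] hf; rewrite big_cons => f0.
have fs : {in s, forall k, f k = 0}.
  (* Applying [Der] minus its eigenvalue in degree k0 to the vanishing sum removes the k0 component
     and scales the others by k - k0, which is nonzero in characteristic 0. The induction hypothesis
     applies to the shorter sum. *)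
  have hg k : homog k ((k - k0)%:~R *: f k) by exact: homogZ.
  have g0 : \sum_(k <- s) (k - k0)%:~R *: f k = 0.
    pose ev k : K := k%:~R - Delta kap lam.
    have D0 : ev k0 *: f k0 + \sum_(k <- s) ev k *: f k = 0.
      rewrite -(verma_act_der_homog (hf k0)).
      under eq_bigr do rewrite -(verma_act_der_homog (hf _)).
      by rewrite -linear_sum -linearD /= f0 linear0.
    apply: etrans (_ : _ - ev k0 *: (f k0 + \sum_(k <- s) f k) = 0); last first.
      by rewrite f0 scaler0 subr0; exact: D0.
    rewrite scalerDr opprD addrACA subrr add0r scaler_sumr -sumrB.
    apply: eq_bigr => k _.
    by rewrite -scalerBl /ev; congr (_ *: _); rewrite rmorphB /=; ring.
  move=> k ks; have /eqP := IH _ us hg g0 k ks.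
  rewrite scaler_eq0 intr_eq0 subr_eq0 => /orP[/eqP kk0|/eqP //].
  by rewrite -kk0 ks in k0s.
move=> k; rewrite inE => /orP[/eqP ->|]; last exact: fs.
by move: f0; rewrite big_seq big1 ?addr0.
Qed.

(** Since [homog_comp] chooses a decomposition, its value is known only once decompositions are
    unique; two of them are compared by [homog_indep] on a common finite list of degrees. *)
Lemma homog_comp_sum (s : seq int) (f : int -> V) d :
    uniq s -> (forall k, homog k (f k)) -> (forall k, k \notin s -> f k = 0) ->
  homog_comp d (\sum_(k <- s) f k) = f d.
Proof.
move=> us hf fs; rewrite /homog_comp.
have fin_f : finite_set [set k | f k != 0].
  apply: (sub_finite_set _ (finite_seq s)) => k /= fk.
  by apply: contraNT fk => /fs ->.
have sumE (g : int -> V) r : uniq r -> (forall k, k \notin r -> g k = 0) ->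
    \sum_(k \in [set: int]) g k = \sum_(k <- r) g k.
  move=> ur gr; rewrite (fsbigE r) //; last by move=> k _; exact: gr.
  by apply: eq_bigl => k; rewrite in_setT.
have decf : homog_decomp (\sum_(k <- s) f k) f.
  by split=> //; rewrite (sumE _ _ us fs).
apply: xget_subset1; first by exists f.
suff decE g : homog_decomp (\sum_(k <- s) f k) g -> g d = f d.
  by move=> _ _ [g1 dg1 <-] [g2 dg2 <-]; rewrite !decE.
(* The degree [d] is added to the list so that independence can be read off at [d] even when it lies
   in neither support. *)
case=> hg fin_g; pose r := undup (d :: s ++ fset_set [set k | g k != 0]).
have ur : uniq r by exact: undup_uniq.
have gr k : k \notin r -> g k = 0.
  rewrite mem_undup inE mem_cat !negb_or => /and3P[_ _].
  by rewrite in_fset_set // notin_setE /= => /negP; rewrite negbK => /eqP.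
have fr k : k \notin r -> f k = 0.
  by rewrite mem_undup inE mem_cat !negb_or => /and3P[_ + _]; exact: fs.
rewrite -(sumE f s) // (sumE f r) // (sumE g r) // => fg.
apply/esym/eqP; rewrite -subr_eq0; apply/eqP.
apply: (@homog_indep r (fun k => f k - g k)) => //.
- move=> k; rewrite addrC -scaleN1r; exact: homog_comb.
- by rewrite sumrB fg subrr.
- by rewrite mem_undup inE eqxx.
Qed.

(** The generator is homogeneous, and each basis element of [gtilde] maps homogeneous vectors to
    homogeneous vectors. *)
Lemma homog_exists (w : V) : exists (s : seq int) (f : int -> V),
  [/\ uniq s, forall k, homog k (f k), forall k, k \notin s -> f k = 0
    & w = \sum_(k <- s) f k].
Proof.
(* Degrees may repeat in the list, so that addition is concatenation; terms of equal degree are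
   collected only at the end. *)
pose P (w : V) := exists2 r : seq (int * V),
  {in r, forall p, homog p.1 p.2} & w = \sum_(p <- r) p.2.
suff [r hr ->] : P w.
  exists (undup [seq p.1 | p <- r]), (fun k => \sum_(p <- r | p.1 == k) p.2).
  split=> [|k|k|].
  - exact: undup_uniq.
  - rewrite big_seq_cond; apply: homog_sum => p /andP[pr /eqP <-]; exact: hr.
  - rewrite mem_undup => kr; rewrite big_seq_cond big1 // => p /andP[pr /eqP pk].
    by move: kr; rewrite -pk map_f.
  - under [RHS]eq_bigr do rewrite big_mkcond.
    rewrite exchange_big /= big_seq [RHS]big_seq; apply: eq_bigr => p pr.
    rewrite (bigD1_seq p.1) ?undup_uniq //=; last first.
      by rewrite mem_undup map_f.
    rewrite eqxx big1 ?addr0 // => k kp.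
    by rewrite eq_sym (negbTE kp).
have PD a u w' : P u -> P w' -> P (a *: u + w').
  case=> [r hr ->] [r' hr' ->].
  exists ([seq (p.1, a *: p.2) | p <- r] ++ r').
    move=> p; rewrite mem_cat => /orP[/mapP[q qr ->] /=|]; last exact: hr'.
    exact/homogZ/hr.
  by rewrite big_cat big_map scaler_sumr.
have PZ a u : P u -> P (a *: u).
  move=> Pu; rewrite -[_ *: u]addr0; apply: PD => //.
  by exists [::]; rewrite ?big_nil.
elim/ind_mod_ind: w => // [|x w Pw].
  exists [:: (0, verma_gen lam kap)]; last by rewrite big_seq1.
  by move=> p; rewrite inE => /eqP ->; exact: homog_gen.
rewrite -[ind_act _ _]/(act x w) verma_actE /linext.
apply: (big_ind P) => [|u u' hu hu'|a _].
- by exists [::]; rewrite ?big_nil.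
- by rewrite -[u]scale1r; exact: PD.
apply: PZ; case: Pw => r hr ->; rewrite linear_sum /=.
case: a => [y p||].
- exists [seq (p + q.1, act << Loop y p >> q.2) | q <- r]; last by rewrite big_map.
  by move=> _ /mapP[q qr ->] /=; apply/homog_act/hr.
- exists [seq (q.1, kap *: q.2) | q <- r].
    by move=> _ /mapP[q qr ->] /=; apply/homogZ/hr.
  by rewrite big_map; apply: eq_bigr => q _; rewrite verma_act_cen.
- exists [seq (q.1, (q.1%:~R - Delta kap lam) *: q.2) | q <- r].
    by move=> _ /mapP[q qr ->] /=; apply/homogZ/hr.
  rewrite big_map big_seq [RHS]big_seq; apply: eq_bigr => q qr.
  exact/verma_act_der_homog/hr.
Qed.

End Grading.

(** * Partitions by multiplicities, and the removal of one part *)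

Section Multiplicities.
Context (n : nat).
Implicit Types nu : {ffun 'I_n -> 'I_n.+1}.

(** Extension by zero makes multiplicities of partitions of different integers functions of one
    type. *)
Definition mult nu (l : nat) : nat := oapp (fun i => nu i : nat) 0%N (insub l).

Lemma mult_ord nu (i : 'I_n) : mult nu i = nu i.
Proof. by rewrite /mult valK. Qed.

Lemma mult_out nu l : (n <= l)%N -> mult nu l = 0%N.
Proof. by move=> nl; rewrite /mult insubF // ltnNge nl. Qed.

Lemma mult_le nu l : (mult nu l <= n)%N.
Proof.
have [nl|ln] := leqP n l; first by rewrite mult_out.
by rewrite (mult_ord nu (Ordinal ln)) -ltnS.
Qed.

Lemma mult_inj nu nu' : mult nu =1 mult nu' -> nu = nu'.
Proof.
by move=> E; apply/ffunP => i; apply/val_inj; rewrite /= -!mult_ord.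
Qed.

Lemma mult_ffun (a : nat -> nat) l :
    (forall i, (i < n)%N -> (a i <= n)%N) ->
    (forall i, (n <= i)%N -> a i = 0%N) ->
  mult [ffun i : 'I_n => inord (a i) : 'I_n.+1] l = a l.
Proof.
move=> an a0; have [nl|ln] := leqP n l; first by rewrite mult_out // a0.
rewrite (mult_ord _ (Ordinal ln)) ffunE inordK // ltnS; exact: an.
Qed.

Lemma partitionsE nu :
  (nu \in partitions n) = (\sum_(l < n) l.+1 * mult nu l == n)%N.
Proof. by rewrite inE; under [in RHS]eq_bigr do rewrite mult_ord. Qed.

End Multiplicities.

Lemma big_ord_stable (R : Type) (idx : R) (op : Monoid.law idx) (F : nat -> R)
    (p n : nat) :
    (p <= n)%N -> (forall l, (p <= l)%N -> F l = idx) ->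
  \big[op/idx]_(l < n) F l = \big[op/idx]_(l < p) F l.
Proof.
move=> pn F1; rewrite -!(big_mkord xpredT F) (@big_cat_nat _ _ _ p) //=.
rewrite [X in op _ X]big1_seq ?Monoid.mulm1 // => l.
by rewrite mem_index_iota => /andP[_ /andP[/F1]].
Qed.

Lemma big_ord_bump (R : Type) (idx : R) (op : Monoid.com_law idx) (n q : nat)
    (x : R) :
  (q < n)%N -> \big[op/idx]_(l < n) (if l == q :> nat then x else idx) = x.
Proof.
move=> qn; rewrite (bigD1 (Ordinal qn)) //= eqxx big1 ?Monoid.mulm1 // => l lq.
rewrite (_ : (l == q :> nat) = false) //.
by apply: contraNF lq => /eqP lq; apply/eqP/val_inj.
Qed.

Section Partitions.
Context (n q : nat).
Hypothesis qn : (q < n)%N.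

(** Together with [part_rem] this is the bijection between partitions of n - (q+1) and partitions of
    n having a part q+1. *)
Definition part_add (nu : {ffun 'I_(n - q.+1) -> 'I_(n - q.+1).+1}) :
    {ffun 'I_n -> 'I_n.+1} :=
  [ffun l : 'I_n => inord (mult nu l + (l == q :> nat))].

Definition part_rem (nu : {ffun 'I_n -> 'I_n.+1}) :
    {ffun 'I_(n - q.+1) -> 'I_(n - q.+1).+1} :=
  [ffun l : 'I_(n - q.+1) => inord (mult nu l - (l == q :> nat))].

Lemma sum_mult_bump (a : nat -> nat) :
  (\sum_(l < n) l.+1 * (a l + (l == q :> nat))
   = \sum_(l < n) l.+1 * a l + q.+1)%N.
Proof.
under eq_bigr do rewrite mulnDr.
rewrite big_split /= -(@big_ord_bump _ _ addn n q q.+1 qn); congr addn.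
by apply: eq_bigr => l _; case: eqP => [->|_]; rewrite ?muln1 ?muln0.
Qed.

Lemma mult_part_add nu l : mult (part_add nu) l = (mult nu l + (l == q))%N.
Proof.
apply: (@mult_ffun _ (fun l => mult nu l + (l == q))%N) => i ni.
  by have := mult_le nu i; case: (i == q) => /=; lia.
by rewrite mult_out ?(leq_trans (leq_subr _ _) ni) // (gtn_eqF (leq_trans qn ni)).
Qed.

(** The point is that [inord] does not truncate: after removal the parts of size i+1 still
    contribute at most n - (q+1). *)
Lemma mult_part_rem nu l : nu \in partitions n -> (0 < mult nu q)%N ->
  mult (part_rem nu) l = (mult nu l - (l == q))%N.
Proof.
rewrite partitionsE => /eqP nuP nuq.
(* This bound yields both conditions of [mult_ffun]: the new multiplicity is at most n - (q+1), and
   it is 0 once i reaches n - (q+1). *)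
have nu_bound i : (i.+1 * (mult nu i - (i == q)) <= n - q.+1)%N.
  have [ni|iN] := leqP n i; first by rewrite mult_out // sub0n muln0.
  have E : (\sum_(l < n) l.+1 * (mult nu l - (l == q :> nat)) = n - q.+1)%N.
    rewrite -[n in RHS]nuP.
    have -> : \sum_(l < n) (l.+1 * mult nu l)%N
      = (\sum_(l < n) l.+1 * (mult nu l - (l == q :> nat) + (l == q :> nat)))%N.
      apply: eq_bigr => k _; case: eqP => [->|_]; last by rewrite subn0 addn0.
      by rewrite subnK.
    by rewrite (sum_mult_bump (fun l => mult nu l - (l == q))%N) addnK.
  by rewrite -E (bigD1 (Ordinal iN)) //= leq_addr.
apply: (@mult_ffun _ (fun l => mult nu l - (l == q))%N) => i ni.
  by have := nu_bound i; nia.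
by have := nu_bound i; nia.
Qed.

Lemma part_addK nu : part_rem (part_add nu) = nu.
Proof.
apply/mult_inj => l; rewrite /part_rem.
rewrite (@mult_ffun _ (fun l => mult (part_add nu) l - (l == q))%N) => [|i _|i ni].
- by rewrite mult_part_add addnK.
- by rewrite mult_part_add addnK mult_le.
- by rewrite mult_part_add addnK mult_out.
Qed.

Lemma part_remK nu : nu \in partitions n -> (0 < mult nu q)%N ->
  part_add (part_rem nu) = nu.
Proof.
move=> nuP nuq; apply/mult_inj => l; rewrite mult_part_add mult_part_rem //.
by case: eqP => [->|_]; rewrite ?subn0 ?addn0 // subnK.
Qed.

Lemma part_add_partitions nu :
  (part_add nu \in partitions n) = (nu \in partitions (n - q.+1)).
Proof.
rewrite !partitionsE; under eq_bigr do rewrite mult_part_add.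
rewrite (sum_mult_bump (mult nu)).
rewrite (@big_ord_stable _ _ addn (fun l => l.+1 * mult nu l)%N (n - q.+1)).
- by move: (\sum_(l < n - q.+1) _)%N => S; apply/eqP/eqP; lia.
- exact: leq_subr.
- by move=> l nl; rewrite mult_out // muln0.
Qed.

(** The summand is a function of multiplicities on all of [nat], so the same [F] makes sense for
    partitions of n and of n - (q+1). *)
Lemma partitions_reindex (V : nmodType) (F : (nat -> nat) -> V) :
  \sum_(nu in partitions n | (0 < mult nu q)%N) F (mult nu)
  = \sum_(nu in partitions (n - q.+1)) F (fun l => mult nu l + (l == q))%N.
Proof.
rewrite (reindex_onto part_add part_rem) => [|nu /andP[]]; last exact: part_remK.
apply: eq_big => [nu|nu _]; last first.
  by congr F; apply/funext => l; rewrite mult_part_add.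
by rewrite part_addK eqxx andbT part_add_partitions mult_part_add eqxx addn1 andbT.
Qed.

End Partitions.

(** * The recursion satisfied by the coefficients [beta] *)

Section Vertex.
Context (K : numFieldType) (lam kap : K) (m : nat) (beta1 : K).
Hypothesis kap0 : kap != 0.
Hypothesis m0 : (0 < m)%N.
Local Notation V := (imag_verma lam kap).
Local Notation act := (@verma_act K lam kap).
Local Notation beta_fun N a :=
  (beta kap m beta1 (fun l : 'I_N => a (nat_of_ord l))).
Local Notation h_fun N a := (h_mono (fun l : 'I_N => a (nat_of_ord l))).

(** One more part q+1 multiplies the power quotient by m / (-2 kap) and the denominators by q+1 and
    by a_q + 1. This is the recursion that annihilation by h_(q+1) demands. *)
Lemma beta_bump N (a : nat -> nat) q : (q < N)%N ->
  beta_fun N (fun l => a l + (l == q))%N * ((a q).+1%:R * (2 * kap * q.+1%:R))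
  = - (m%:R * beta_fun N a).
Proof.
move=> qN; rewrite /beta.
have -> : (\sum_(l < N) (a l + (l == q :> nat)) = (\sum_(l < N) a l).+1)%N.
  rewrite big_split /= -addn1; congr addn.
  rewrite -[RHS](@big_ord_bump _ _ addn N q 1 qN).
  by apply: eq_bigr => l _; case: eqP.
have -> : \prod_(l < N) l.+1%:R ^+ (a l + (l == q :> nat))
    = \prod_(l < N) l.+1%:R ^+ a l * q.+1%:R :> K.
  rewrite -[q.+1%:R](@big_ord_bump _ _ *%R N q _ qN) -big_split /=.
  by apply: eq_bigr => l _; case: eqP => [->|_]; rewrite exprD ?expr1 ?expr0.
have -> : \prod_(l < N) (a l + (l == q :> nat))`!%:R
    = \prod_(l < N) (a l)`!%:R * (a q).+1%:R :> K.
  rewrite -[(a q).+1%:R](@big_ord_bump _ _ *%R N q _ qN) -big_split /=.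
  apply: eq_bigr => l _; case: eqP => [->|_]; last by rewrite addn0 mulr1.
  by rewrite addn1 factS mulnC natrM.
set S := (\sum_(l < N) a l)%N.
have mn0 : m%:R != 0 :> K by rewrite pnatr_eq0 -lt0n.
have k20 : - (2 * kap) != 0 by rewrite oppr_eq0 mulf_neq0 // pnatr_eq0.
(* The exponent S - 1 equals -1 for the empty partition, so the base must be invertible. *)
have expS (x : K) : x != 0 -> x ^ (S.+1%:Z - 1) = x * x ^ (S%:Z - 1).
  by move=> x0; rewrite -[in RHS](expr1z x) -expfzDr //; congr (x ^ _); lia.
rewrite !expS //.
have P0 : \prod_(l < N) l.+1%:R ^+ a l != 0 :> K.
  by apply/prodf_neq0 => l _; rewrite expf_neq0 // pnatr_eq0.
have F0 : \prod_(l < N) (a l)`!%:R != 0 :> K.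
  by apply/prodf_neq0 => l _; rewrite pnatr_eq0 -lt0n fact_gt0.
have Y0 : (- (2 * kap)) ^ (S%:Z - 1) != 0 by exact: expfz_neq0.
move: (m%:R ^ _) Y0 P0 F0 => X.
move: (_ ^ _) (\prod_(l < N) _) (\prod_(l < N) _) => Y P F Y0 P0 F0.
have q0 : q.+1%:R != 0 :> K by rewrite pnatr_eq0.
have a0 : (a q).+1%:R != 0 :> K by rewrite pnatr_eq0.
move: (q.+1%:R) ((a q).+1%:R) q0 a0 => u w u0 w0.
by field; rewrite kap0 Y0 P0 F0 u0 w0.
Qed.

End Vertex.

(** * The Heisenberg subalgebra acting on monomials *)

Section Heisenberg.
Context (K : numFieldType) (lam kap : K).
Local Notation V := (imag_verma lam kap).
Local Notation act := (@verma_act K lam kap).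
Local Notation raise l := (act << Loop bas_h (- (l.+1 : int)) >>).
Local Notation h_fun N a := (h_mono (fun l : 'I_N => a (nat_of_ord l))).

Lemma verma_act_h_h p r (w : V) :
  act << Loop bas_h p >> (act << Loop bas_h r >> w)
  = act << Loop bas_h r >> (act << Loop bas_h p >> w)
    + ((p + r == 0)%:R * p%:~R * (2 * kap)) *: w.
Proof.
apply/eqP; rewrite addrC -subr_eq; apply/eqP.
apply: etrans (verma_act_br_loop _ _ _ _ _) _.
rewrite subrr trform_hh verma_act_cen scalerA.
have -> : loop_mx (0 : 'M[K]_2) (p + r) = 0.
  by rewrite /loop_mx !mxE !scale0r !addr0.
by rewrite verma_act0l add0r mulrA.
Qed.

Lemma verma_act_h_e p r (w : V) :
  act << Loop bas_h r >> (act << Loop bas_e p >> w)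
  = act << Loop bas_e p >> (act << Loop bas_h r >> w)
    + 2 *: act << Loop bas_e (r + p) >> w.
Proof.
apply/eqP; rewrite addrC -subr_eq; apply/eqP.
apply: etrans (verma_act_br_loop _ _ _ _ _) _.
rewrite trform_he mulr0 scale0r addr0 sl2_br_he.
apply: etrans (verma_act_loop_mx _ _ _) _.
have [-> -> ->] : [/\ (sl2_mx K bas_e *+ 2) 0 1 = 2, (sl2_mx K bas_e *+ 2) 1 0 = 0
    & (sl2_mx K bas_e *+ 2) 0 0 = 0].
  by rewrite !mulmxnE !mxE /= !mul0rn.
have comb (z : K) (x y t : V) : z *: x + 0 *: y + 0 *: t = z *: x.
  by rewrite !scale0r !addr0.
exact: comb.
Qed.

(** Moving e_p past h_r produces e_(r+p), so all modes of e have to be treated at once. *)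
Lemma verma_act_e_h r (w : V) :
  (forall p, act << Loop bas_e p >> w = 0) ->
  forall p, act << Loop bas_e p >> (act << Loop bas_h r >> w) = 0.
Proof.
move=> ew p; have := verma_act_h_e p r w.
by rewrite (ew p) (ew (r + p)) scaler0 addr0 => <-; exact: linear0.
Qed.

(** Indices become natural numbers, which allows monomials over ranges of different lengths to be
    compared. *)
Lemma h_mono_iota N (a : nat -> nat) (w : V) :
  h_fun N a w = foldr (fun l => iter (a l) (raise l)) w (iota 0 N).
Proof. by rewrite -val_enum_ord foldr_map. Qed.

Lemma h_mono_stable (p n : nat) (a : nat -> nat) (w : V) :
    (p <= n)%N -> (forall l, (p <= l)%N -> a l = 0%N) ->
  h_fun n a w = h_fun p a w.
Proof.
move=> pn a0; rewrite !h_mono_iota -(subnKC pn) iotaD foldr_cat add0n.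
suff drop0 l k : (p <= l)%N ->
    foldr (fun l => iter (a l) (raise l)) w (iota l k) = w.
  by rewrite drop0.
by elim: k l => //= k IH l pl; rewrite IH ?a0 // leqW.
Qed.

Lemma h_mono_ind N (ns : 'I_N -> nat) (P : V -> Prop) w :
    (forall l u, P u -> P (raise l u)) -> P w -> P (h_mono ns w).
Proof.
move=> Pr Pw; rewrite /h_mono; elim: (enum 'I_N) => //= l s IH.
by elim: (ns l) => //= k; exact: Pr.
Qed.

Lemma h_mono_is_linear N (ns : 'I_N -> nat) :
  linear (h_mono ns : V -> V).
Proof.
move=> z u w; rewrite /h_mono; elim: (enum 'I_N) => //= l s ->.
by elim: (ns l) => //= k ->; rewrite linearP.
Qed.

HB.instance Definition _ N (ns : 'I_N -> nat) :=
  GRing.isLinear.Build K V V _ (h_mono ns) (h_mono_is_linear ns).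

Lemma h_mono_homog N (ns : 'I_N -> nat) k (w : V) :
  homog k w -> homog (k - (\sum_(l < N) l.+1 * ns l)%N%:Z) (h_mono ns w).
Proof.
move=> hw; rewrite /h_mono -big_enum /=.
elim: (enum 'I_N) => /= [|l s IH]; first by rewrite big_nil subr0.
rewrite big_cons addnC; move: (\sum_(_ <- s) _)%N (foldr _ _ _) IH => S u hu.
elim: (ns l) => [|j IH] /=; first by rewrite muln0 addn0.
rewrite (_ : k - _ = - (l.+1 : int) + (k - (S + l.+1 * j)%N%:Z)); last by lia.
exact: homog_act.
Qed.

Lemma iter_raise0 l k : iter k (raise l) 0 = 0 :> V.
Proof. by elim: k => [|k IH] //; rewrite iterS IH; exact: linear0. Qed.

Lemma iter_raiseZ l k z (w : V) :
  iter k (raise l) (z *: w) = z *: iter k (raise l) w.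
Proof. by elim: k => [|k IH] //; rewrite !iterS IH; exact: linearZ. Qed.

Section Lowering.
Context (q : nat).
Local Notation low := (act << Loop bas_h (q.+1 : int) >>).

(** Leibniz rule: h_(q+1) acts on powers as 2 kap (q+1) times the derivative in h_(-(q+1)). At k = 0
    the coefficient is 0, so the value of [k.-1] is harmless. *)
Lemma low_iter_raise l k (w : V) :
  low (iter k (raise l) w) = iter k (raise l) (low w)
    + (if l == q then (k%:R * (2 * kap * q.+1%:R)) *: iter k.-1 (raise l) w
       else 0).
Proof.
elim: k => [|k IH] /=; first by rewrite mul0r scale0r if_same addr0.
rewrite verma_act_h_h IH linearD -addrA; congr (_ + _).
rewrite subr_eq0 -[(_ == _ :> int)]/(q.+1 == l.+1) eqSS eq_sym.
case: eqP => [->|_]; last by rewrite linear0 !mul0r scale0r addr0.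
rewrite linearZ /= mul1r; case: k {IH} => [|k] /=.
  rewrite mul0r scale0r add0r; congr (_ *: _).
  by rewrite -pmulrn; ring.
rewrite -scalerDl; congr (_ *: _).
by rewrite -pmulrn -[k.+2%:R]natr1; ring.
Qed.

Lemma low_foldr0 (a : nat -> nat) s (w : V) :
    low w = 0 -> (q \in s -> a q = 0%N) ->
  low (foldr (fun l => iter (a l) (raise l)) w s) = 0.
Proof.
move=> w0; elim: s => //= l s IH a0; rewrite low_iter_raise IH; last first.
  by move=> qs; rewrite a0 // inE qs orbT.
rewrite iter_raise0; case: eqP => [lq|_]; last by rewrite addr0.
by rewrite lq a0 ?inE ?lq ?eqxx // mul0r scale0r addr0.
Qed.

(** The derivative of a monomial in a variable that occurs once in the list; writing its exponent as
    a_q + 1 avoids a predecessor. *)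
Lemma low_foldr (a : nat -> nat) s (w : V) :
    low w = 0 -> uniq s -> q \in s ->
  low (foldr (fun l => iter (a l + (l == q)) (raise l)) w s)
  = ((a q).+1%:R * (2 * kap * q.+1%:R))
    *: foldr (fun l => iter (a l) (raise l)) w s.
Proof.
move=> w0; elim: s => //= l s IH /andP[ls us]; rewrite inE low_iter_raise.
case: (eqVneq l q) => [lq _|lq]; last first.
  rewrite /= => qs; rewrite IH // addn0 addr0.
  exact: iter_raiseZ.
have qs : q \notin s by rewrite -lq.
rewrite (@low_foldr0 (fun l => a l + (l == q))%N) //; last by rewrite (negbTE qs).
rewrite iter_raise0 add0r addn1 /= lq; congr (_ *: iter _ _ _).
(* The head was the only occurrence of [q], so no exponent in the tail is increased. *)
elim: s qs {IH ls us} => //= l' s IH; rewrite inE negb_or eq_sym => /andP[lq' qs].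
by rewrite IH // (negbTE lq') addn0.
Qed.

Lemma low_h_mono N (a : nat -> nat) (w : V) : low w = 0 -> (q < N)%N ->
  low (h_fun N (fun l => a l + (l == q))%N w)
  = ((a q).+1%:R * (2 * kap * q.+1%:R)) *: h_fun N a w.
Proof.
move=> w0 qN; rewrite (h_mono_iota N a).
rewrite (h_mono_iota N (fun l => a l + (l == q))%N).
by apply: low_foldr => //; [exact: iota_uniq | rewrite mem_iota].
Qed.

End Lowering.
End Heisenberg.

(** * The coefficients of the vertex operator *)

Section VertexCoef.
Context (K : numFieldType) (lam kap : K) (m : nat) (beta1 : K).
Hypothesis kap0 : kap != 0.
Hypothesis m0 : (0 < m)%N.
Local Notation V := (imag_verma lam kap).
Local Notation act := (@verma_act K lam kap).
Local Notation beta_fun N a :=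
  (beta kap m beta1 (fun l : 'I_N => a (nat_of_ord l))).
Local Notation h_fun N a := (h_mono (fun l : 'I_N => a (nat_of_ord l))).

(** The operator T_n: its value is the vector paired with u^m z^n. *)
Definition vertex_coef (n : nat) (w : V) : V :=
  \sum_(nu in partitions n)
    beta kap m beta1 (fun l => nu l) *: h_mono (fun l => nu l) w.

Lemma vertex_coefE n w : vertex_coef n w =
  \sum_(nu in partitions n) beta_fun n (mult nu) *: h_fun n (mult nu) w.
Proof.
apply: eq_bigr => nu _.
suff -> : (fun l => nu l : nat) = (fun l : 'I_n => mult nu l) by [].
by apply/funext => l; rewrite mult_ord.
Qed.

Lemma beta_stable p n (a : nat -> nat) :
    (p <= n)%N -> (forall l, (p <= l)%N -> a l = 0%N) ->
  beta_fun n a = beta_fun p a.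
Proof.
move=> pn a0; rewrite /beta.
rewrite (@big_ord_stable _ _ addn a p n) //.
rewrite (@big_ord_stable _ _ *%R (fun l => l.+1%:R ^+ a l) p n) //; last first.
  by move=> l pl; rewrite a0.
rewrite (@big_ord_stable _ _ *%R (fun l => (a l)`!%:R) p n) //.
by move=> l pl; rewrite a0.
Qed.

(** Monomials without h_(-(q+1)) are killed. For the others the derivative removes one part q+1, and
    [beta_bump] turns the resulting factor into -m. *)
Lemma vertex_coef_low (q n : nat) (w : V) :
    act << Loop bas_h q.+1 >> w = 0 ->
  act << Loop bas_h q.+1 >> (vertex_coef n w)
  = if (q < n)%N then - m%:R *: vertex_coef (n - q.+1) w else 0.
Proof.
move=> w0; rewrite !vertex_coefE linear_sum /=.
under eq_bigr do rewrite linearZ /=.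
have low0 (nu : {ffun 'I_n -> 'I_n.+1}) : mult nu q = 0%N ->
    act << Loop bas_h q.+1 >> (h_fun n (mult nu) w) = 0.
  by move=> nuq; rewrite h_mono_iota; apply: low_foldr0.
case: ltnP => qn; last first.
  by rewrite big1 // => nu _; rewrite low0 ?scaler0 // mult_out.
rewrite (bigID (fun nu => 0 < mult nu q)%N) /= [X in _ + X]big1 ?addr0; last first.
  by move=> nu /andP[_]; rewrite -eqn0Ngt => /eqP/low0 ->; rewrite scaler0.
rewrite (partitions_reindex qn (fun a =>
  beta_fun n a *: act << Loop bas_h q.+1 >> (h_fun n a w))).
rewrite scaler_sumr; apply: eq_bigr => nu _.
have nu0 l : (n - q.+1 <= l)%N -> mult nu l = 0%N by exact: mult_out.
apply: etrans (congr1 _ (low_h_mono _ w0 qn)) _.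
(* After reindexing, monomials and coefficients still range over n indices; the last q+1
   multiplicities vanish, so the range shrinks to n - (q+1). *)
rewrite (h_mono_stable _ (leq_subr _ _) nu0) -(beta_stable (leq_subr _ _) nu0).
by rewrite !scalerA (beta_bump beta1 kap0 m0) // mulNr.
Qed.

Lemma vertex_coef_linear n : linear (vertex_coef n).
Proof.
move=> z u w; rewrite /vertex_coef scaler_sumr -big_split.
apply: eq_bigr => nu _ /=.
by rewrite linearP scalerDr !scalerA mulrC.
Qed.

HB.instance Definition _ n :=
  GRing.isLinear.Build K V V _ (vertex_coef n) (vertex_coef_linear n).

(** Only the empty partition contributes, with exponent -1 in both powers. This scalar is what makes
    the homomorphism nonzero when [beta1] is. *)
Lemma vertex_coef0 w : vertex_coef 0 w = (- (2 * kap) / m%:R * beta1) *: w.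
Proof.
rewrite /vertex_coef (big_pred1 [ffun => ord0]); last first.
  move=> nu; rewrite inE big_ord0 eqxx; apply/esym/eqP/ffunP => -[] //.
rewrite /h_mono /beta enum_ord0 /= !big_ord0 !mulr1.
congr (_ *: _).
by rewrite sub0r !exprN1 invrK [_^-1 * _]mulrC.
Qed.

Lemma vertex_coef_homog n k w : homog k w -> homog (k - n%:Z) (vertex_coef n w).
Proof.
move=> hw; apply: homog_sum => nu nuP; apply: homogZ.
by move: nuP; rewrite inE => /eqP {1}<-; exact: h_mono_homog.
Qed.

Lemma vertex_coef_e n w :
  (forall p, act << Loop bas_e p >> w = 0) ->
  forall p, act << Loop bas_e p >> (vertex_coef n w) = 0.
Proof.
move=> ew p; rewrite linear_sum big1 // => nu _; rewrite linearZ /=.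
have -> : act << Loop bas_e p >> (h_mono (fun l => nu l) w) = 0; last exact: scaler0.
move: p.
apply: (@h_mono_ind _ _ _ _ _
  (fun u => forall p, act << Loop bas_e p >> u = 0)).
  by move=> l u; exact: verma_act_e_h.
exact: ew.
Qed.

Lemma vertex_coef_h0 n w : act << Loop bas_h 0 >> w = lam *: w ->
  act << Loop bas_h 0 >> (vertex_coef n w) = lam *: vertex_coef n w.
Proof.
move=> hw; rewrite linear_sum scaler_sumr; apply: eq_bigr => nu _.
rewrite linearZ [RHS]scalerA [lam * _]mulrC -[RHS]scalerA; congr (_ *: _).
apply: (@h_mono_ind _ _ _ _ _ (fun u => act << Loop bas_h 0 >> u = lam *: u)) => //.
by move=> l u hu; rewrite verma_act_h_h hu linearZ /= mulr0 mul0r scale0r addr0.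
Qed.

End VertexCoef.

(** * Stability of the completed tensor product *)

Section CompletedTensor.
Context (K : numFieldType) (lam kap : K) (m : nat).
Local Notation V := (imag_verma lam kap).
Local Notation T := (tfamily lam kap m).

Lemma in_ctensor0 : in_ctensor (0 : T).
Proof.
split=> [d n j||d]; first exact: homog_zero; first by exists 0.
by apply: (sub_finite_set _ (@finite_set0 int)) => n /= /(_ erefl).
Qed.

Lemma in_ctensor_comb a (s t : T) :
  in_ctensor s -> in_ctensor t -> in_ctensor (a *: s + t).
Proof.
move=> [hs [D sD] fs] [ht [E tE] ft]; split=> [d n j||d].
- exact: homog_comb.
- exists (Num.max D E) => d; rewrite gt_max => /andP[Dd Ed].
  by rewrite -[LHS]/(a *: s d + t d) sD ?tE // scaler0 addr0.
- apply: (@sub_finite_set _ _ ([set n | s d n <> 0] `|` [set n | t d n <> 0])).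
    move=> n /= st; apply: contrapT => /not_orP[/contrapT s0 /contrapT t0].
    by apply: st; rewrite -[LHS]/(a *: s d n + t d n) s0 t0 scaler0 addr0.
  by rewrite finite_setU.
Qed.

Lemma in_ctensor_rep_basis c a (t : T) :
  in_ctensor t -> in_ctensor (tensor_rep_basis c a t).
Proof.
move=> [ht [D tD] ft]; case: a => [x p||] /=; split=> [d n j||d].
- apply: homogD; first by rewrite -{1}[d](subrK p) addrC; exact: homog_act.
  by apply: homog_sum => i _; exact: homogZ.
(* Action on the first factor moves the degree bound to D + p; action on the second leaves it at
   D. *)
- exists (Num.max D (D + p)) => d; rewrite gt_max => /andP[Dd Dpd].
  apply/funext => n; apply/funext => j.
  rewrite tD ?ltrBrDr // tD // linear0 add0r big1 // => i _.
  exact: scaler0.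
(* In degree d the exponents come from degree d - p unchanged, through the first factor, or from
   degree d translated by p, through the second. *)
- apply: (@sub_finite_set _ _
    ([set n | t (d - p) n <> 0] `|` (+%R p) @` [set n | t d n <> 0])).
    move=> n /= st; apply: contrapT => /not_orP[/contrapT s0 t0].
    apply: st; apply/funext => j; rewrite s0 linear0 add0r big1 // => i _.
    rewrite (_ : t d (n - p) = 0) ?scaler0 //.
    by apply: contrapT => tn; apply: t0; exists (n - p) => //; rewrite addrC subrK.
  by rewrite finite_setU; split=> //; exact: finite_image.
- by rewrite verma_act_cen; exact: homogZ.
- exists D => d Dd; apply/funext => n; apply/funext => j.
  by rewrite verma_act_cen tD // scaler0.
- apply: sub_finite_set (ft d) => n /= tn tn0; apply: tn; apply/funext => j.
  by rewrite verma_act_cen tn0 scaler0.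
- exact: homogZ.
- exists D => d Dd; apply/funext => n; apply/funext => j.
  by rewrite tD // scaler0.
- apply: sub_finite_set (ft d) => n /= tn tn0; apply: tn; apply/funext => j.
  by rewrite tn0 scaler0.
Qed.

Lemma in_ctensor_rep c x (t : T) :
  in_ctensor t -> in_ctensor (tensor_rep c x t).
Proof.
move=> ht; rewrite /tensor_rep /linext; apply: (big_ind (@in_ctensor _ lam kap m)).
- exact: in_ctensor0.
- by move=> s u hs hu; rewrite -[s]scale1r; exact: in_ctensor_comb.
- move=> a _; rewrite -[_ *: _]addr0.
  by apply: in_ctensor_comb in_ctensor0; exact: in_ctensor_rep_basis.
Qed.

End CompletedTensor.

(** * The generator as an imaginary highest weight vector *)

Section Generator.
Context (K : fieldType) (lam kap : K).

Lemma borel_char_linear : linear (borel_char lam kap : gtilde K -> K^o).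
Proof.
by move=> a x y; rewrite /borel_char !mcoeffD !mcoeffZ /GRing.scale /=; ring.
Qed.

Lemma nplus_notin x a : nplus x -> ~~ in_nplus a -> x@_a = 0 :> K.
Proof. by move=> hx ha; apply: mcoeff_outdom; apply: contra ha => /hx. Qed.

Lemma nplus_ghat x : nplus x -> @ghat K x.
Proof. by move=> /nplus_notin; exact. Qed.

(** These properties are later carried by the homomorphism to the image of the generator. *)
Lemma imag_hwv_gen : imag_hwv (@verma_act K lam kap) lam kap (verma_gen lam kap).
Proof.
split=> [x hx||].
- rewrite [LHS]ind_act_gen => [|a /hx ha]; last by rewrite /in_borel ha.
  by rewrite /borel_char !(nplus_notin hx) // !mulr0 addr0 subr0 scale0r.
- rewrite [LHS]ind_act_gen => [|a].
    by rewrite /borel_char !mcoeffU /= !(mulr0, addr0, subr0, mulr1).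
  by rewrite msuppU oner_eq0 inE => /eqP ->.
- exact: verma_act_cen.
Qed.

End Generator.

(** * The homomorphism attached to a homogeneous singular vector *)

Section VertexFamily.
Context (K : numFieldType) (lam mu kap : K) (m : nat) (beta1 : K).
Hypothesis kap0 : kap != 0.
Hypothesis m0 : (0 < m)%N.
Hypothesis mu_def : mu = lam + m%:R.
Local Notation V := (imag_verma lam kap).
Local Notation act := (@verma_act K lam kap).
Local Notation T := (tfamily lam kap m).

(** T_n extended by 0 to negative exponents of z. *)
Definition vertex_comp (n : int) (w : V) : V :=
  if n is Posz n' then vertex_coef m beta1 n' w else 0.

(** For [w] of degree k, T_n w has degree k - n, so the family lives on the line d + n = k and on
    the coordinate of u^m. *)
Definition vertex_family (k : int) (w : V) : T :=
  fun d n j => if (j == ord0) && (d + n == k) then vertex_comp n w else 0.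

(** The cancellation between the two tensor factors: h_(q+1) T_n w = -m T_(n-q-1) w against the
    eigenvalue m of h on u^m. *)
Lemma vertex_comp_low (q : nat) (n : int) (w : V) :
    act << Loop bas_h q.+1 >> w = 0 ->
  act << Loop bas_h q.+1 >> (vertex_comp n w)
    + m%:R *: vertex_comp (n - q.+1%:Z) w = 0.
Proof.
move=> w0; case: n => n; last first.
  rewrite (_ : Negz n - _ = Negz (n + q.+1)%N); last by lia.
  by rewrite scaler0 addr0; exact: linear0.
rewrite [X in X + _](vertex_coef_low beta1 kap0 m0 n w0).
case: ltnP => qn.
  by rewrite subzn // scaleNr addNr.
by rewrite (_ : Posz n - _ = Negz (q - n)%N) ?scaler0 ?addr0 //; lia.
Qed.

Lemma vertex_comp_homog n k (w : V) :
  homog k w -> homog (k - n) (vertex_comp n w).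
Proof.
case: n => n hw /=; first exact: vertex_coef_homog.
exact: homog_zero.
Qed.

Lemma vertex_comp_e n (w : V) : (forall p, act << Loop bas_e p >> w = 0) ->
  forall p, act << Loop bas_e p >> (vertex_comp n w) = 0.
Proof.
case: n => n ew p /=; first exact: vertex_coef_e.
exact: linear0.
Qed.

Lemma vertex_comp_h0 n (w : V) : act << Loop bas_h 0 >> w = lam *: w ->
  act << Loop bas_h 0 >> (vertex_comp n w) = lam *: vertex_comp n w.
Proof.
case: n => n hw /=; first exact: vertex_coef_h0.
by rewrite scaler0; exact: linear0.
Qed.

Context (k : int) (w : V).
Hypothesis hk : homog k w.
Hypothesis w_e : forall p, act << Loop bas_e p >> w = 0.
Hypothesis w_h : forall q : nat, act << Loop bas_h q.+1 >> w = 0.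
Hypothesis w_h0 : act << Loop bas_h 0 >> w = lam *: w.
Local Notation t := (vertex_family k w).

(** Exponents are nonnegative, so degrees are at most k, and degree d meets only the exponent k -
    d. *)
Lemma vertex_family_in : in_ctensor t.
Proof.
split=> [d n j||d].
- rewrite /vertex_family; case: ifP => [/andP[_ /eqP dn]|_]; last exact: homog_zero.
  by rewrite -[d](addrK n) dn; exact: vertex_comp_homog.
- exists k => d kd; apply/funext => n; apply/funext => j.
  rewrite /vertex_family; case: ifP => // /andP[_ /eqP dn].
  by case: n dn => // n dn; exfalso; lia.
- apply: (@sub_finite_set _ _ [set k - d]); last exact: finite_set1.
  move=> n /= tn; apply: contrapT => nk; apply: tn; apply/funext => j.
  rewrite /vertex_family; case: ifP => // /andP[_ /eqP dn].
  by case: nk; rewrite -dn addrC addKr.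
Qed.

(** With this shift the total degree k gives the eigenvalue k - c = -Delta(mu) of [Der], which is
    the one prescribed on the generator of weight mu. *)
Local Notation c := (k%:~R + Delta kap mu).

Lemma vertex_family_e p : tensor_rep_basis c (Loop bas_e p) t = 0.
Proof.
apply: tfamilyP => d n j /=; rewrite [in X in X + _]/vertex_family.
have -> : \sum_i fin_mx K m bas_e j i *: t d (n - p) i = 0.
  (* Only the coordinate of u^m can be nonzero, and e kills u^m. *)
  rewrite big1 // => i _; rewrite /vertex_family; case: eqP => [->|_] /=.
    by rewrite mxE mul0r scale0r.
  exact: scaler0.
rewrite addr0; case: ifP => _; first exact: vertex_comp_e.
exact: linear0.
Qed.

Lemma vertex_family_fin_h d n j :
  \sum_i fin_mx K m bas_h j i *: t d n i = m%:R *: t d n j.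
Proof.
rewrite (bigD1 j) //= big1 => [|i ij]; last first.
  by rewrite mxE (negbTE ij) mul0r scale0r.
rewrite addr0 mxE eqxx mul1r /vertex_family.
case: eqP => [->|_] /=; last by rewrite !scaler0.
by rewrite subr0.
Qed.

Lemma vertex_family_h q : tensor_rep_basis c (Loop bas_h (Posz q.+1)) t = 0.
Proof.
apply: tfamilyP => d n j.
apply: etrans (congr1 _ (vertex_family_fin_h _ _ _)) _.
(* Both terms are supported on the same line d + n - (q+1) = k, so one case distinction covers
   them. *)
rewrite /vertex_family addrAC addrA.
case: ifP => _; first exact: vertex_comp_low.
by rewrite scaler0 addr0; exact: linear0.
Qed.

Lemma vertex_family_h0 : tensor_rep_basis c (Loop bas_h 0) t = mu *: t.
Proof.
apply: tfamilyP => d n j.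
apply: etrans (congr1 _ (vertex_family_fin_h _ _ _)) _.
rewrite !subr0 tfamilyZ mu_def scalerDl; congr (_ + _).
rewrite /vertex_family; case: ifP => _; first exact: vertex_comp_h0.
by rewrite scaler0; exact: linear0.
Qed.

Lemma vertex_family_der :
  tensor_rep_basis c Der t = - Delta kap mu *: t.
Proof.
apply: tfamilyP => d n j; rewrite tfamilyZ /= /vertex_family.
case: ifP => [/andP[_ /eqP ->]|_]; last by rewrite !scaler0.
by congr (_ *: _); ring.
Qed.

Lemma vertex_family_borel_basis a : in_borel a ->
  tensor_rep_basis c a t = borel_char mu kap << a >> *: t.
Proof.
case: a => [[] p||] ba.
- apply: etrans (vertex_family_e _) _.
  by rewrite /borel_char !mcoeffU /= !(mulr0, mulr1, oppr0, add0r, addr0, scale0r).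
- by [].
- case: p ba => [[|q]|] // _.
    apply: etrans vertex_family_h0 _.
    by rewrite /borel_char !mcoeffU /= !(mulr0, mulr1, oppr0, add0r, addr0).
  apply: etrans (vertex_family_h _) _.
  by rewrite /borel_char !mcoeffU /= !(mulr0, oppr0, addr0, scale0r).
- apply: tfamilyP => d n j; apply: etrans (verma_act_cen _) _.
  by rewrite /borel_char !mcoeffU /= !(mulr0, mulr1, oppr0, add0r, addr0, scale0r).
- apply: etrans vertex_family_der _.
  by rewrite /borel_char !mcoeffU /= !(mulr0, mulr1, oppr0, add0r, addr0, scale0r).
Qed.

Lemma vertex_family_borel x : borel x ->
  tensor_rep c x t = borel_char mu kap x *: t.
Proof.
move=> bx; rewrite [borel_char _ _ x](linear_linext (borel_char_linear mu kap)).
rewrite /tensor_rep /linext scaler_suml big_seq [RHS]big_seq.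
apply: eq_bigr => a ax.
by rewrite vertex_family_borel_basis ?scalerA //; exact: bx.
Qed.

(** The universal property is applied to the [gtilde]-module of all families; on [ghat] its action
    is [ctensor_act]. The image stays in the completed tensor product because the image of the
    generator lies there and the action preserves it. *)
Lemma vertex_hom : exists Phi : {linear imag_verma mu kap -> T},
  [/\ forall u, in_ctensor (Phi u),
      forall x u, ghat x -> Phi (verma_act x u) = ctensor_act x (Phi u)
    & Phi (verma_gen mu kap) = t].
Proof.
have [Phi [Phi_act Phi_gen]] := ind_mod_univ (@tensor_rep_linl K lam kap m c)
  (@tensor_rep_linr K lam kap m c) (@tensor_rep_br K lam kap m c)
  vertex_family_borel.
exists Phi; split=> [|x u hx|]; last exact: Phi_gen.
- elim/ind_mod_ind => [a u u' hu hu'||x u hu].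
  + by rewrite linearP; exact: in_ctensor_comb.
  + by rewrite Phi_gen; exact: vertex_family_in.
  + by rewrite Phi_act; exact: in_ctensor_rep.
- by rewrite -(tensor_rep_ghat c) // -Phi_act.
Qed.

End VertexFamily.

(** * Decomposition into homogeneous components and the sum of the homomorphisms *)

Section Main.
Context (K : numFieldType) (lam mu kap : K) (m : nat) (beta1 : K).
Hypothesis kap0 : kap != 0.
Hypothesis m0 : (0 < m)%N.
Hypothesis mu_def : mu = lam + m%:R.
Local Notation V := (imag_verma lam kap).
Local Notation act := (@verma_act K lam kap).
Local Notation T := (tfamily lam kap m).

(** X_p translates all degrees by p, so the images of distinct components remain in distinct degrees
    and must vanish separately. *)
Lemma homog_sum_eq0 (s : seq int) (f : int -> V) x p :
    uniq s -> (forall k, homog k (f k)) ->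
    act << Loop x p >> (\sum_(k <- s) f k) = 0 ->
  {in s, forall k, act << Loop x p >> (f k) = 0}.
Proof.
move=> us hf; rewrite linear_sum => f0 k ks.
rewrite -(addKr p k); move: (f0).
have -> : \sum_(k <- s) act << Loop x p >> (f k)
    = \sum_(k <- [seq p + k | k <- s]) act << Loop x p >> (f (- p + k)).
  by rewrite big_map; apply: eq_bigr => i _; rewrite addKr.
move=> g0.
apply: (@homog_indep _ _ _ _ (fun k => act << Loop x p >> (f (- p + k))) _ _ g0).
- by rewrite map_inj_uniq //; exact: addrI.
- by move=> i; have := homog_act x p (hf (- p + i)); rewrite addNKr.
- by rewrite map_f.
Qed.

(** The monomials of a partition of N lower degrees by N, so at exponent n the component of degree d
    comes from [f (d + n)] alone. *)
Lemma v_sharpE (s : seq int) (f : int -> V) d n j :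
    uniq s -> (forall k, homog k (f k)) -> (forall k, k \notin s -> f k = 0) ->
  (v_sharp beta1 (\sum_(k <- s) f k) : T) d n j
  = if j == ord0 then vertex_comp m beta1 n (f (d + n)) else 0.
Proof.
move=> us hf fs; rewrite /v_sharp.
have termE (N : nat) : (\sum_(nu in partitions N)
       beta kap m beta1 (fun l => nu l) *: (pure_tensor
         (h_mono (fun l => nu l) (\sum_(k <- s) f k)) ord0 N : T)) d n j
    = if (n == N) && (j == ord0) then vertex_coef m beta1 N (f (d + n)) else 0.
  rewrite tfamily_sum; case: ifP => nj; last first.
    by rewrite big1 // => nu _; rewrite tfamilyZ /pure_tensor nj scaler0.
  apply: eq_bigr => nu; rewrite inE => /eqP nuN; rewrite tfamilyZ /pure_tensor nj.
  congr (_ *: _).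
  have nN : n = N by move: nj => /andP[/eqP].
  rewrite linear_sum /=.
  have -> : \sum_(k <- s) h_mono (fun l => nu l) (f k)
      = \sum_(k <- [seq k - N%:Z | k <- s]) h_mono (fun l => nu l) (f (k + N%:Z)).
    by rewrite big_map; apply: eq_bigr => k _; rewrite subrK.
  rewrite nN (@homog_comp_sum _ _ _ _
    (fun k => h_mono (fun l => nu l) (f (k + N%:Z)))) //.
  - by rewrite map_inj_uniq //; exact: addIr.
  - move=> k; rewrite -{1}[k](addrK N%:Z).
    by rewrite -{2}nuN; exact: h_mono_homog.
  - move=> k ks; rewrite fs ?linear0 //; apply: contra ks => kNs.
    by apply/mapP; exists (k + N%:Z); rewrite ?addrK.
under eq_fsbigr do rewrite termE.
(* The sum over N has the single term N = n, and none at all when n is negative. *)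
clear termE; case: n => n; last first.
  rewrite fsbig1 //=; first by rewrite if_same.
rewrite (fsbigE [:: n]) //=; last first.
  move=> N _; rewrite inE => nN; case: ifP => // /andP[/eqP[nN']].
  by rewrite nN' eqxx in nN.
by rewrite big_cons big_nil in_setT addr0 eqxx.
Qed.

Lemma v_sharp_sum (s : seq int) (f : int -> V) :
    uniq s -> (forall k, homog k (f k)) -> (forall k, k \notin s -> f k = 0) ->
  (v_sharp beta1 (\sum_(k <- s) f k) : T)
  = \sum_(k <- s) vertex_family beta1 k (f k).
Proof.
move=> us hf fs; apply: tfamilyP => d n j; rewrite v_sharpE // tfamily_sum.
have vc0 : vertex_comp m beta1 n (0 : V) = 0.
  by case: n => n //=; exact: linear0.
rewrite /vertex_family; case: eqP => [_|_] /=; last by rewrite big1.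
have [dns|dns] := boolP (d + n \in s).
  rewrite (bigD1_seq (d + n)) //= eqxx big1 ?addr0 // => k kdn.
  by rewrite eq_sym (negbTE kdn).
rewrite (fs _ dns) vc0 big_seq big1 // => k ks.
by case: eqP => // kdn; rewrite kdn ks in dns.
Qed.

(** The maps for the components use different shifts of [Der], but the shift is invisible on [ghat],
    so their sum is still equivariant there. *)
Lemma v_sharp_hom (v : V) : imag_hwv act lam kap v ->
  exists Phi : {linear imag_verma mu kap -> T},
  [/\ forall u, in_ctensor (Phi u),
      forall x u, ghat x -> Phi (verma_act x u) = ctensor_act x (Phi u)
    & Phi (verma_gen mu kap) = v_sharp beta1 v].
Proof.
have [s [f [us hf fs ->]]] := homog_exists v.
move=> [v_n v_h0 _]; rewrite v_sharp_sum //.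
have nU a : in_nplus a -> nplus (<< a >> : gtilde K).
  by move=> ha b; rewrite msuppU oner_eq0 inE => /eqP ->.
have f_e k : k \in s -> forall p, act << Loop bas_e p >> (f k) = 0.
  by move=> ks p; apply: homog_sum_eq0 ks => //; apply/v_n/nU.
have f_h k : k \in s -> forall q, act << Loop bas_h (Posz q.+1) >> (f k) = 0.
  by move=> ks q; apply: homog_sum_eq0 ks => //; apply/v_n/nU.
have f_h0 k : k \in s -> act << Loop bas_h 0 >> (f k) = lam *: f k.
  (* The vectors h_0 f_k - lam f_k are homogeneous of degree k and add up to 0, hence each
     vanishes. *)
  move=> ks; apply/eqP; rewrite -subr_eq0; apply/eqP; move: k ks.
  apply: (@homog_indep _ _ _ _ (fun k => act << Loop bas_h 0 >> (f k) - lam *: f k)).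
  - exact: us.
  - move=> k; rewrite addrC -scaleNr; apply: homog_comb => //.
    by have := homog_act bas_h 0 (hf k); rewrite add0r.
  - by rewrite sumrB -linear_sum -scaler_sumr; apply/eqP; rewrite subr_eq0; apply/eqP.
elim: (s) f_e f_h f_h0 => [|k r IH] f_e f_h f_h0.
  exists \0; split=> [u|x u hx|] /=; last by rewrite big_nil.
    exact: in_ctensor0.
  (* The shift 0 is arbitrary: passing to [tensor_rep] gives access to its linearity in the
     family. *)
  rewrite -(tensor_rep_ghat 0) //.
  have := @tensor_rep_linr _ _ _ _ 0 x (-1) 0 (0 : T).
  by rewrite scaler0 addr0 scaleN1r addNr.
have [|||Phi [Phi1 Phi2 Phi3]] := IH.
- by move=> i ir; apply: f_e; rewrite inE ir orbT.
- by move=> i ir; apply: f_h; rewrite inE ir orbT.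
- by move=> i ir; apply: f_h0; rewrite inE ir orbT.
have kr : k \in k :: r by rewrite inE eqxx.
have [Psi [Psi1 Psi2 Psi3]] := vertex_hom beta1 kap0 m0 mu_def (hf k)
  (f_e k kr) (f_h k kr) (f_h0 k kr).
exists (Psi \+ Phi); split=> [u|x u hx|] /=.
- by rewrite -[Psi u]scale1r; exact: in_ctensor_comb.
- rewrite Psi2 // Phi2 // -!(tensor_rep_ghat 0) //.
  have := @tensor_rep_linr _ _ _ _ 0 x 1 (Psi u) (Phi u).
  by rewrite !scale1r => ->.
- by rewrite Psi3 Phi3 big_cons.
Qed.
End Main.

Theorem proposition5p1p6 (R : realType) (lambda kappa beta1 : R[i]) (m : nat)
    (kappa_neq0 : kappa != 0) (kappa_noncritical : kappa != - 2)
    (m_gt0 : (0 < m)%N)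
    (v : imag_verma (lambda - m%:R) kappa)
    (hv : imag_hwv (@verma_act _ _ _) (lambda - m%:R) kappa v) :
  let vs : tfamily (lambda - m%:R) kappa m := v_sharp beta1 v in
  [/\ in_ctensor vs,
      imag_hwv (@ctensor_act _ _ _ _) lambda kappa vs
    & exists Phi : {linear imag_verma lambda kappa ->
                           tfamily (lambda - m%:R) kappa m},
        [/\ forall w, in_ctensor (Phi w),
            forall x w, ghat x -> Phi (verma_act x w) = ctensor_act x (Phi w),
            Phi (verma_gen lambda kappa) = vs
          & v != 0 -> beta1 != 0 -> exists w, Phi w <> 0]].
Proof.
move=> vs.
have mu_def : lambda = lambda - m%:R + m%:R by rewrite subrK.
have [Phi [Phi_in Phi_act Phi_gen]] :=
  v_sharp_hom beta1 kappa_neq0 m_gt0 mu_def hv.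
have [gen_n gen_h gen_c] := imag_hwv_gen lambda kappa.
have hU a : a != Der -> ghat (<< a >> : gtilde R[i]).
  by move=> aD; rewrite /ghat mcoeffU (negbTE aD).
split.
- by rewrite /vs -Phi_gen.
(* The highest weight property is deduced from the homomorphism: relations satisfied by the
   generator hold for its image. *)
- rewrite /vs -Phi_gen; split=> [x hx||].
  + by rewrite -Phi_act ?gen_n ?linear0 //; exact: nplus_ghat.
  + by rewrite -Phi_act ?gen_h ?linearZ //; exact: hU.
  + by rewrite -Phi_act ?gen_c ?linearZ //; exact: hU.
- exists Phi; split=> // v0 b0; exists (verma_gen lambda kappa).
  rewrite Phi_gen; have [s [f [us hf fs vE]]] := homog_exists v.
  (* At exponent 0 and degree k the family is T_0 f_k, a nonzero multiple of f_k; if the family were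
     0, all components of [v] would vanish. *)
  move=> vs0; case/eqP: v0; rewrite vE big1 // => k _.
  have := congr1 (fun t : tfamily (lambda - m%:R) kappa m => t k 0 ord0) vs0.
  rewrite vE v_sharpE // eqxx /= addr0 vertex_coef0 => /eqP.
  rewrite scaler_eq0 => /orP[|/eqP //].
  rewrite !mulf_eq0 oppr_eq0 mulf_eq0 invr_eq0 !pnatr_eq0.
  by rewrite (negbTE kappa_neq0) (negbTE b0) (gtn_eqF m_gt0).
Qed.
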